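(* Let $M,N\ge3$ be integers. (1) Let $x\in\{-1,1\}^N$, $y\in\{-1,1\}^M$. If $k(x)$ and $k(y)$ are both non-zero, then the number of nontrivial toroidal Hitomezashi loops in $\mathrm{Cloth}_{M,N}(x,y)$ is $\gcd(x,y)$. (2) For all $x\in\{-1,1\}^N$, $y\in\{-1,1\}^M$, the number of trivial toroidal Hitomezashi loops in $\mathrm{Cloth}_{M,N}(x,y)$ is even. (3) For all $x\in\{-1,1\}^N$, the total number of toroidal Hitomezashi loops in the symmetric pattern $\mathrm{Cloth}_{N,N}(x,x)$ is congruent to $N$ modulo $4$. (4) The minimum, over all $x\in\{-1,1\}^N$, of the total number of toroidal Hitomezashi loops in the symmetric pattern $\mathrm{Cloth}_{N,N}(x,x)$ is $N$.
   Context: Let $M,N\ge3$. $\mathrm{Cloth}_{M,N}$ is the graph with vertex set $\mathbb Z/M\mathbb Z\times\mathbb Z/N\mathbb Z$, with $(i,j)$ adjacent to $(i\pm1,j)$ and $(i,j\pm1)$. For $x\in\{-1,1\}^N$ (indexed by $\mathbb Z/N\mathbb Z$) and $y\in\{-1,1\}^M$ (indexed by $\mathbb Z/M\mathbb Z$), the toroidal Hitomezashi pattern $\mathrm{Cloth}_{M,N}(x,y)$ is the following orientation of $\mathrm{Cloth}_{M,N}$: the horizontal edge $\{(i,j),(i+1,j)\}$ is oriented $(i,j)\to(i+1,j)$ if $x_j=1$ and $(i+1,j)\to(i,j)$ if $x_j=-1$; the vertical edge $\{(i,j),(i,j+1)\}$ is oriented $(i,j)\to(i,j+1)$ if $y_i=1$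 and $(i,j+1)\to(i,j)$ if $y_i=-1$. The pattern is symmetric if $M=N$ and $x=y$. A toroidal Hitomezashi loop is a directed circuit (closed directed trail, no repeated edges, considered up to cyclic shift) in $\mathrm{Cloth}_{M,N}(x,y)$ whose edges alternate (cyclically) between vertical and horizontal edges; a loop may pass through a vertex twice. The edge set is partitioned into such loops. For a loop, $\Delta x$ is the number of its edges of the form $(i,j)\to(i+1,j)$ minus the number of its edges of the form $(i+1,j)\to(i,j)$, and $\Delta y$ is the number of its edges of the form $(i,j)\to(i,j+1)$ minus the number of the form $(i,j+1)\to(i,j)$. The homology class of the loop is $(\Delta x/M,\Delta y/N)$. A loop is trivial if its homology class is $(0,0)$ and nontrivial otherwise. For a string $x$ of $\pm1$'s, $k(x)$ is the number of $1$'s minus the number of $(-1)$'s in $x$. $\gcd(x,y)$ denotes $\gcd(|k(x)|,|k(y)|)$. *)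

(* Defs.v *)
From mathcomp Require Import all_boot all_order all_algebra.

Set Implicit Arguments.
Unset Strict Implicit.
Unset Printing Implicit Defensive.

Import GRing.Theory.
Local Open Scope ring_scope.

Section SignStrings.

Variable n : nat.

Definition is_sign_string (x : {ffun 'Z_n -> int}) : Prop :=
  forall i, x i = 1 \/ x i = -1.

Definition k (x : {ffun 'Z_n -> int}) : int :=
  #|[pred i | x i == 1]|%:Z - #|[pred i | x i == -1]|%:Z.

End SignStrings.

Section Cloth.

(* Everything below is meant for 3 <= M and 3 <= N: then 'Z_M and 'Z_N really
   are the integers mod M and mod N, [east], [west], [north] and [south] are
   mutually exclusive, and no edge occurs in a pattern with both orientations.
   In particular a walk along arcs repeats an edge iff it repeats an arc. *)
Variables M N : nat.

Definition vertex := ('Z_M * 'Z_N)%type.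

(* A directed edge is the pair (tail, head). *)
Definition dedge := (vertex * vertex)%type.

Definition east  (e : dedge) : bool := e.2 == (e.1.1 + 1, e.1.2).
Definition west  (e : dedge) : bool := e.1 == (e.2.1 + 1, e.2.2).
Definition north (e : dedge) : bool := e.2 == (e.1.1, e.1.2 + 1).
Definition south (e : dedge) : bool := e.1 == (e.2.1, e.2.2 + 1).

Definition horizontal (e : dedge) : bool := east e || west e.
Definition vertical (e : dedge) : bool := north e || south e.

(* The arcs of Cloth_{M,N}(x, y): row j is oriented by x_j and column i by y_i. *)
Definition arc (x : {ffun 'Z_N -> int}) (y : {ffun 'Z_M -> int}) (e : dedge) :
    bool :=
  [|| east e && (x e.1.2 == 1), west e && (x e.1.2 == -1),
      north e && (y e.1.1 == 1) | south e && (y e.1.1 == -1)].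

(* [cycle] also relates the last edge to the first one. *)
Definition alternating_circuit x y (c : seq dedge) : bool :=
  [&& c != [::], all (arc x y) c, uniq c,
      path.cycle (fun e f => e.2 == f.1) c &
      path.cycle (fun e f => (horizontal e && vertical f)
                          || (vertical e && horizontal f)) c].

(* Circuits have no repeated edge, so the length bound excludes none of them;
   it only serves to make the type of candidates finite. *)
Definition dedges := #|{: dedge}|.-bseq dedge.

Definition cyclic_shift (c d : dedges) : bool :=
  [exists m : 'I_(size c).+1, (d : seq dedge) == rot m c].

(* A loop is an equivalence class of alternating circuits up to cyclic shift. *)
Definition loops x y : {set {set dedges}} :=
  equivalence_partition cyclic_shift
    [set c : dedges | alternating_circuit x y c].

Definition Delta_x (c : seq dedge) : int :=
  (count east c)%:Z - (count west c)%:Z.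

Definition Delta_y (c : seq dedge) : int :=
  (count north c)%:Z - (count south c)%:Z.

Definition homology_class (c : seq dedge) : rat * rat :=
  ((Delta_x c)%:~R / M%:R, (Delta_y c)%:~R / N%:R).

(* The homology class is invariant under cyclic shift, so it is the same for
   all circuits [c] of a loop [L]; and [L] is never empty. *)
Definition trivial_loop (L : {set dedges}) : bool :=
  [forall c in L, homology_class c == (0, 0)].

Definition trivial_loops x y : {set {set dedges}} :=
  [set L in loops x y | trivial_loop L].

Definition nontrivial_loops x y : {set {set dedges}} :=
  [set L in loops x y | ~~ trivial_loop L].

End Cloth.

(* Main.v *)
(* Going through a row edge and then a column edge is a permutation [turn] of
   the vertices, T = V o H with H (i, j) = (i + x_j, j) and
   V (i, j) = (i, j + y_i), and the loops are its cycles.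

   Let X and Y be the walks with increments x and y.  Lifted to the plane, a
   loop follows a level curve of X(t) - Y(s): two climbers on the profiles X and
   Y who always keep the same difference of altitudes.  Hence the class (p, q) of
   a loop satisfies q k(x) = p k(y).  If k(x) and k(y) are positive, let t and s
   be the first times at which X and Y reach two given altitudes.  No curve of
   the corresponding level enters the quadrant to the lower left of (s, t), and a
   curve can leave it only at its corner.  So there is exactly one unbounded
   curve on each level, every nontrivial loop has class (k(x), k(y)) / gcd, and
   since the classes add up to (k(x), k(y)) there are gcd of them.  If
   k(x) = 0, a climber who reaches the maximum or the minimum of X has to turn
   back, and a loop that goes around in the direction of t has class (0, 1) or
   (0, -1).  The number of trivial loops is even since H has N cycles and V has
   M cycles, which gives the sign of T and so the parity of all its cycles.

   If x = y, then T = S^2 with S (i, j) = (j, i + x_j), so that T has twice as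
   many cycles as S minus the number of cycles of S of odd length.  The sign of S
   does not depend on x.  A cycle of odd length is symmetric; its class is
   (1, 1) or (-1, -1), which forces N to be odd, and its level is determined, so
   there is at most one.  Comparing with a constant string, which has N loops,
   gives the congruence modulo 4.

   For the lower bound, delete two consecutive rows of signs 1, -1.  The first
   return of T to the other rows is the turn of the shorter pattern composed with
   one transposition for each local maximum of Y, while each local minimum of Y
   gives a cycle inside the deleted rows; so the number of cycles does not
   increase.  Doing this for rows and columns and using the congruence, N loops
   are needed. *)

From Stdlib Require Import ZArith Lia.
Require Import Defs.
From mathcomp Require Import all_boot all_order all_algebra all_fingroup.
From mathcomp Require Import zify ssrZ.

Set Implicit Arguments.
Unset Strict Implicit.
Unset Printing Implicit Defensive.

Import Order.TTheory GRing.Theory Num.Theory.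

Local Delimit Scope Z_scope with zz.

#[local] Arguments Z.mul : simpl never.
#[local] Arguments Z.add : simpl never.

(** * Level curves of a difference of two walks *)

Section Contours.

Local Open Scope Z_scope.

(* Time is doubled: even times are the midpoints of the steps of the original
   walk, so that its local extrema are at odd times. *)
Definition walk (W : Z -> Z) : Prop :=
  (forall t, W (t + 1) = W t + 1 \/ W (t + 1) = W t - 1) /\
  (forall t, W (2 * t + 1) - W (2 * t) = W (2 * t) - W (2 * t - 1)).

(** The slope of X across the step is a and that of Y is b: the sign of a row gives the horizontal
    direction, the sign of a column the vertical one. Both altitudes change by a b, so their
    difference is kept. *)
Definition contour_step (X Y : Z -> Z) (p p' : Z * Z) : Prop :=
  exists a b : Z,
    [/\ a = 1 \/ a = -1, b = 1 \/ b = -1, p' = (p.1 + a, p.2 + b),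
        X (p.2 + b) = X p.2 + a * b & Y (p.1 + a) = Y p.1 + a * b].

(** The odd coordinate sum means that at each point exactly one of the two walks is at an even time,
    where it is straight. *)
Definition contour (X Y : Z -> Z) (p : nat -> Z * Z) : Prop :=
  (forall r, contour_step X Y (p r) (p (S r))) /\
  (exists k, (p O).1 + (p O).2 = 2 * k + 1).

Definition level (X Y : Z -> Z) (p : Z * Z) : Z := X p.2 - Y p.1.

Definition record (W : Z -> Z) (t : Z) : Prop :=
  forall t', t' < t -> W t' < W t.

Lemma walk_pred W t : walk W -> W (t - 1) = W t + 1 \/ W (t - 1) = W t - 1.
Proof. by move=> [W1 _]; have := W1 (t - 1); rewrite Z.sub_add; lia. Qed.

Lemma walk_lipschitz W t t' :
  walk W -> t <= t' -> W t' <= W t + (t' - t) /\ W t - (t' - t) <= W t'.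
Proof.
move=> [W1 _] letu; have [n ->] : exists n, t' = t + Z.of_nat n by exists (Z.to_nat (t' - t)); lia.
elim: n => [|n IHn]; first by rewrite Z.add_0_r; lia.
have -> : t + Z.of_nat n.+1 = t + Z.of_nat n + 1 by lia.
have := W1 (t + Z.of_nat n); lia.
Qed.

Lemma drift_iter (W : Z -> Z) L K : (forall t, W (t + L) = W t + K) ->
  forall m t, W (t + m * L) = W t + m * K.
Proof.
move=> WL; have natE (m : nat) t : W (t + Z.of_nat m * L) = W t + Z.of_nat m * K.
  elim: m t => [|m IHm] t; first by rewrite !Z.mul_0_l !Z.add_0_r.
  have -> : t + Z.of_nat m.+1 * L = t + Z.of_nat m * L + L by lia.
  by rewrite WL IHm; lia.
move=> m t; have [m0|m0] : 0 <= m \/ m < 0 by lia.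
  by have := natE (Z.to_nat m) t; rewrite Z2Nat.id.
have := natE (Z.to_nat (- m)) (t + m * L); rewrite Z2Nat.id; last lia.
have -> : t + m * L + - m * L = t by lia.
lia.
Qed.

(** A positive drift sends W to minus infinity on the left, so there is a first time at which W is
    at least v, and unit steps force equality there. *)
Lemma record_ex W L K : walk W -> 0 < L -> 0 < K ->
  (forall t, W (t + L) = W t + K) ->
  forall v, exists2 t, W t = v & record W t.
Proof.
move=> wW L0 K0 WL v; have WLm := drift_iter WL.
have [lo Wlo] : exists lo, forall t, t < lo -> W t < v.
  (* Each period further to the left lowers W by at least 1; the summand L + 1 pays for the
     variation within a period. *)
  exists (- ((Z.abs (W 0 - v) + L + 1) * L)) => t tlo.
  have := Z.div_mod t L; have := Z.mod_pos_bound t L L0.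
  move: (t / L) (t mod L) => q r rL tE.
  have qlt : q < - (Z.abs (W 0 - v) + L + 1) by nia.
  have -> : t = r + q * L by lia.
  rewrite WLm; have := @walk_lipschitz W 0 r wW.
  have : q * K <= q by nia.
  lia.
have ex : exists n : nat, (v <=? W (lo + Z.of_nat n)).
  pose m := Z.abs (v - W lo); exists (Z.to_nat (m * L)).
  rewrite Z2Nat.id; last nia.
  rewrite WLm; have : m <= m * K by nia.
  lia.
case: (ex_minnP ex) => n vW nmin; exists (lo + Z.of_nat n); last first.
  move=> t' lt; suff : W t' < v by lia.
  have [/Wlo //|le] : t' < lo \/ lo <= t' by lia.
  have [//|vt] : W t' < v \/ v <= W t' by lia.
  have := nmin (Z.to_nat (t' - lo)).
  rewrite Z2Nat.id; last lia.
  by rewrite Zplus_minus; lia.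
have Wp : W (lo + Z.of_nat n - 1) < v.
  case: n vW nmin => [|n] vW nmin; first by apply: Wlo; lia.
  have -> : lo + Z.of_nat n.+1 - 1 = lo + Z.of_nat n by lia.
  have := nmin n; lia.
have := walk_pred (lo + Z.of_nat n) wW; lia.
Qed.

Lemma record_inj W t t' : record W t -> t' <= t -> W t' = W t -> t' = t.
Proof. by move=> rW le eq; have := rW t'; lia. Qed.

Lemma record_shift W e K t :
  (forall t, W (t + e) = W t + K) -> record W t -> record W (t + e).
Proof.
move=> We rW t' lt; rewrite We -(Z.sub_add e t') We.
by have := rW (t' - e); lia.
Qed.

Variables X Y : Z -> Z.
Hypotheses (wX : walk X) (wY : walk Y).

Lemma contour_odd p : contour X Y p ->
  forall r, exists k, (p r).1 + (p r).2 = 2 * k + 1.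
Proof.
move=> [pS p0]; elim=> // r [k pk].
have [a [b [ha hb -> _ _ /=]]] := pS r.
case: ha => ->; case: hb => ->; [exists (k + 1)|exists k|exists k|exists (k - 1)]; lia.
Qed.

Lemma contour_level p : contour X Y p ->
  forall r, level X Y (p r) = level X Y (p O).
Proof.
move=> [pS _]; elim=> // r <-; rewrite /level.
by have [a [b [ha hb -> /= -> ->]]] := pS r; lia.
Qed.

Section Quadrant.

Variables s t : Z.
Hypotheses (rX : record X t) (rY : record Y s).

Definition quadrant (p : Z * Z) := p.1 <= s /\ p.2 <= t.

(* The corner is the only point of its level on the upper or right side of the
   quadrant, and it is not a local maximum of both walks since s + t is odd. *)
Lemma quadrant_backward p p' :
  contour_step X Y p p' -> level X Y p = level X Y (s, t) ->
  (exists k, p.1 + p.2 = 2 * k + 1) -> quadrant p' -> quadrant p.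
Proof.
case: p => ps pt [a [b [ha hb -> /= Xb Ya]]] lv [k /= odd_p].
rewrite /level /= in lv; rewrite /quadrant /= => -[les let_].
have Xp : X (t - 1) = X t - 1 by have := walk_pred t wX; have := rX (t' := t - 1); lia.
have Yp : Y (s - 1) = Y s - 1 by have := walk_pred s wY; have := rY (t' := s - 1); lia.
have pos : ps + a = s -> pt + b = t.
  by move=> e; apply: record_inj rX let_ _; rewrite Xb; move: Ya; rewrite e; lia.
have pot : pt + b = t -> ps + a = s.
  by move=> e; apply: record_inj rY les _; rewrite Ya; move: Xb; rewrite e; lia.
have [lt|e] : (ps + a < s /\ pt + b < t) \/ ps + a = s by lia.
  by case: ha; case: hb; lia.
have e' := pos e; rewrite e e' in Xb Ya.
have eps : ps = s - a by lia.
have ept : pt = t - b by lia.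
subst ps pt.
case: ha => ha; case: hb => hb; subst a b; try lia.
have eps : s - -1 = s + 1 by lia.
have ept : t - -1 = t + 1 by lia.
rewrite eps ept in Xb Ya odd_p.
have [[j tE]|[j tE]] := Z.Even_or_Odd t.
  by case: wX => _ /(_ j); rewrite -tE; lia.
have sE : s = 2 * (k - j - 1) by lia.
by case: wY => _ /(_ (k - j - 1)); rewrite -sE; lia.
Qed.

Lemma quadrant_exit p p' :
  contour_step X Y p p' -> level X Y p = level X Y (s, t) ->
  quadrant p -> ~ quadrant p' -> p = (s, t).
Proof.
case: p => ps pt [a [b [ha hb -> /= _ _]]]; rewrite /level /quadrant /=.
move=> lv [les let_] nq.
have [e|[e|ne]] : ps = s \/ pt = t \/ ps < s /\ pt < t by lia.
- by rewrite e (record_inj rX let_) //; move: lv; rewrite e; lia.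
- by rewrite e (record_inj rY les) //; move: lv; rewrite e; lia.
by case: nq; case: ha; case: hb; lia.
Qed.

(** Followed backwards, a curve of this level cannot get out of the quadrant. *)
Lemma quadrant_not_entered p r : contour X Y p ->
  level X Y (p O) = level X Y (s, t) -> quadrant (p r) -> quadrant (p O).
Proof.
move=> cp lv; elim: r => // r IHr q; apply: IHr; apply: quadrant_backward q.
- by case: cp.
- by rewrite contour_level.
- exact: contour_odd.
Qed.

Lemma quadrant_left_at_corner p r : contour X Y p ->
  level X Y (p O) = level X Y (s, t) ->
  quadrant (p O) -> ~ quadrant (p r) -> exists i, p i = (s, t).
Proof.
move=> cp lv q0; elim: r => // r IHr nq.
have [/IHr//|q] : ~ quadrant (p r) \/ quadrant (p r) by rewrite /quadrant; lia.
by exists r; apply: quadrant_exit q nq; [case: cp | rewrite contour_level].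
Qed.

End Quadrant.

Lemma drift_path (p : nat -> Z * Z) n D1 D2 :
  (forall r, p (r + n)%N = ((p r).1 + D1, (p r).2 + D2)) ->
  forall m : nat, p (m * n)%N = ((p O).1 + Z.of_nat m * D1, (p O).2 + Z.of_nat m * D2).
Proof.
move=> pn; elim=> [|m IHm]; first by rewrite mul0n !Z.add_0_r; case: (p O).
by rewrite mulSn addnC pn IHm /=; congr pair; lia.
Qed.

End Contours.

(** * Unbounded level curves when both drifts are positive *)

Section PositiveDrift.

Local Open Scope Z_scope.

Variables (X Y : Z -> Z) (L1 L2 K1 K2 : Z).
Hypotheses (wX : walk X) (wY : walk Y) (L1p : 0 < L1) (L2p : 0 < L2).
Hypotheses (XL : forall t, X (t + L2) = X t + K2).
Hypotheses (YL : forall t, Y (t + L1) = Y t + K1).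
Hypotheses (K1p : 0 < K1) (K2p : 0 < K2).

(** L1 and L2 are the doubled periods of the torus, and (u, v) is the homology class of the closed
    curve. *)
Definition periodic_contour (p : nat -> Z * Z) (u v : Z) : Prop :=
  contour X Y p /\ exists n,
  forall r, p (r + n)%N = ((p r).1 + u * L1, (p r).2 + v * L2).

(** The level is the same after one period, while X has risen by v K2 and Y by u K1. *)
Lemma drift_slope p u v : periodic_contour p u v -> v * K2 = u * K1.
Proof.
move=> [cp [n pn]]; have := contour_level cp n.
have := pn O; rewrite add0n => ->; rewrite /level /=.
rewrite (drift_iter XL) (drift_iter YL); lia.
Qed.

(** The slope relation gives u and v the same sign. If both were negative, the curve would
    eventually enter every quadrant, even one of its own level that does not contain its starting
    point. *)
Lemma drift_positive p u v : periodic_contour p u v -> (u, v) <> (0, 0) ->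
  0 < u /\ 0 < v.
Proof.
move=> pp uv0; have sl := drift_slope pp; case: pp => cp [n pn].
have [//|[u0 v0]] : (0 < u /\ 0 < v) \/ (u < 0 /\ v < 0).
  have [u0|] : u = 0 \/ u <> 0 by lia.
    have v0 : v = 0 by nia.
    by case: uv0; rewrite u0 v0.
  nia.
(* A corner one unit lower in both altitudes has the level of the curve and leaves the starting
   point outside. *)
have [t Xt rt] := record_ex wX L2p K2p XL (X (p O).2 - 1).
have [s Ys rs] := record_ex wY L1p K1p YL (Y (p O).1 - 1).
have lv : level X Y (p O) = level X Y (s, t) by rewrite /level /=; lia.
pose m := Z.to_nat (Z.abs ((p O).1 - s) + Z.abs ((p O).2 - t)).
have := quadrant_not_entered wX wY rt rs (r := (m * n)%N) cp lv.
rewrite (drift_path pn) /quadrant /=.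
have -> : Z.of_nat m = Z.abs ((p O).1 - s) + Z.abs ((p O).2 - t) by rewrite Z2Nat.id; lia.
have mN x y : x < 0 -> 0 <= y -> y * x <= - y by nia.
have uL : u * L1 < 0 by nia.
have vL : v * L2 < 0 by nia.
have := mN _ (Z.abs ((p O).1 - s) + Z.abs ((p O).2 - t)) uL.
have := mN _ (Z.abs ((p O).1 - s) + Z.abs ((p O).2 - t)) vL.
move=> h2 h1 [|les let_]; first by lia.
have := rt (p O).2; have : (p O).2 <> t by move=> e; rewrite e in Xt; lia.
lia.
Qed.

(** Before the record t of altitude W a the walk is below W a, and after t it needs at least |a - t|
    steps to climb |a - t| higher. *)
Lemma record_far W L K a : walk W -> 0 < L -> 0 < K ->
  (forall t, W (t + L) = W t + K) ->
  exists v0, forall t, v0 <= W t -> record W t -> a <= t.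
Proof.
move=> wW L0 K0 WL; have [t Wt rt] := record_ex wW L0 K0 WL (W a).
exists (W a + Z.abs (a - t)) => t' vt rt'.
have [lt|le] : t' < t \/ t <= t' by lia.
  have := rt t' lt; lia.
have := walk_lipschitz wW le; lia.
Qed.

(** A high corner lies beyond the starting point in both coordinates, so the curve starts inside the
    quadrant; its positive class makes it leave, which is possible only through the corner. *)
Lemma contour_visits_records p u v : periodic_contour p u v -> (u, v) <> (0, 0) ->
  exists v0, forall s t, v0 <= X t -> record X t -> record Y s ->
    level X Y (s, t) = level X Y (p O) -> exists r, p r = (s, t).
Proof.
move=> pp uv0; have [u0 v0] := drift_positive pp uv0; case: pp => cp [n pn].
have [w1 far1] := record_far (p O).1 wY L1p K1p YL.
have [w2 far2] := record_far (p O).2 wX L2p K2p XL.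
exists (Z.max w2 (w1 + level X Y (p O))) => s t Xt rt rs lv.
have sp : (p O).1 <= s by apply: far1 => //; move: lv; rewrite {1}/level /=; lia.
have tp : (p O).2 <= t by apply: far2 => //; lia.
pose m := Z.to_nat (s - (p O).1 + 1).
apply: (quadrant_left_at_corner (r := (m * n)%N) rt rs cp) => //.
rewrite (drift_path pn) /quadrant /=.
have -> : Z.of_nat m = s - (p O).1 + 1 by rewrite Z2Nat.id; lia.
have uL : 0 < u * L1 by nia.
have : (s - (p O).1 + 1) * 1 <= (s - (p O).1 + 1) * (u * L1).
  by apply: Z.mul_le_mono_nonneg_l; lia.
lia.
Qed.

(** Both curves visit all sufficiently high corners of their level, and the shift by (e1, e2) takes
    such corners to corners of the same level. *)
Lemma contours_meet p p' u v u' v' e1 e2 K :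
  periodic_contour p u v -> (u, v) <> (0, 0) ->
  periodic_contour p' u' v' -> (u', v') <> (0, 0) ->
  level X Y (p O) = level X Y (p' O) ->
  (forall t, X (t + e2) = X t + K) -> (forall t, Y (t + e1) = Y t + K) ->
  exists r r', p' r' = ((p r).1 + e1, (p r).2 + e2).
Proof.
move=> pp uv0 pp' uv0' lv Xe Ye.
have [w vis] := contour_visits_records pp uv0.
have [w' vis'] := contour_visits_records pp' uv0'.
(* High enough for the first curve at t and, after the rise by K, for the second one at t + e2. *)
have [t Xt rt] := record_ex wX L2p K2p XL (Z.max w (w' - K)).
have [s Ys rs] := record_ex wY L1p K1p YL (X t - level X Y (p O)).
have [r pr] : exists r, p r = (s, t) by apply: vis => //; rewrite /level /= in Ys *; lia.
have [r' pr'] : exists r', p' r' = (s + e1, t + e2).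
  apply: vis' => //; rewrite ?Xe; try (by apply: record_shift; eassumption); first lia.
  by rewrite -lv /level /= Xe Ye; rewrite /level in Ys; lia.
by exists r, r'; rewrite pr pr'.
Qed.

End PositiveDrift.

(** * Reduction of nonzero drifts to positive ones by symmetry *)

Section AnyDrift.

Local Open Scope Z_scope.

(** Quantifying over the walks makes this a property of periods and drifts alone, on which
    reflections of the plane act. The inequality on u K2 records the direction in which a nontrivial
    curve runs. *)
Definition meeting_property (L1 L2 K1 K2 : Z) : Prop :=
  forall X Y, walk X -> walk Y ->
  (forall t, X (t + L2) = X t + K2) -> (forall t, Y (t + L1) = Y t + K1) ->
  forall p p' u v u' v' e1 e2 K,
    periodic_contour X Y L1 L2 p u v -> (u, v) <> (0, 0) ->
    periodic_contour X Y L1 L2 p' u' v' -> (u', v') <> (0, 0) ->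
    level X Y (p O) = level X Y (p' O) ->
    (forall t, X (t + e2) = X t + K) -> (forall t, Y (t + e1) = Y t + K) ->
  0 < u * K2 /\ exists r r', p' r' = ((p r).1 + e1, (p r).2 + e2).

Lemma meeting_pos L1 L2 K1 K2 : 0 < L1 -> 0 < L2 -> 0 < K1 -> 0 < K2 ->
  meeting_property L1 L2 K1 K2.
Proof.
move=> L1p L2p K1p K2p X Y wX wY XL YL p p' u v u' v' e1 e2 K pp uv pp' uv' lv Xe Ye.
split; first by have [] := drift_positive wX wY L1p L2p XL YL K1p K2p pp uv; nia.
exact: (contours_meet wX wY L1p L2p XL YL K1p K2p pp uv pp' uv' lv Xe Ye).
Qed.

Definition mirror (p : nat -> Z * Z) (r : nat) := (- (p r).1, (p r).2).

Lemma walk_opp W : walk W -> walk (fun t => - W t).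
Proof. by move=> [W1 W2]; split=> t; [have := W1 t | have := W2 t]; lia. Qed.

Lemma walk_rotate W : walk W -> walk (fun t => - W (- t)).
Proof.
move=> wW; split=> t.
  by have := walk_pred (- t) wW; rewrite (_ : - t - 1 = - (t + 1)); lia.
case: wW => _ /(_ (- t)).
have -> : - (2 * t + 1) = 2 * (- t) - 1 by lia.
have -> : - (2 * t - 1) = 2 * (- t) + 1 by lia.
have -> : - (2 * t) = 2 * (- t) by lia.
lia.
Qed.

(** Reversing the horizontal direction negates the slope of X, whereas rotating the graph of Y by a
    half turn keeps its slopes. *)
Lemma mirror_contour X Y L1 L2 p u v : periodic_contour X Y L1 L2 p u v ->
  periodic_contour (fun t => - X t) (fun t => - Y (- t)) L1 L2 (mirror p) (- u) v.
Proof.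
move=> [[pS [k p0]] [n pn]]; split; [split|].
- move=> r; have [a [b [ha hb pr Xb Ya]]] := pS r; exists (- a), b.
  rewrite /mirror pr /=; split=> //; try lia.
    by congr pair; lia.
  have -> : - (- (p r).1 + - a) = (p r).1 + a by lia.
  rewrite Z.opp_involutive; lia.
- by exists (k - (p O).1); rewrite /mirror /=; lia.
- by exists n => r; rewrite /mirror pn /=; congr pair; lia.
Qed.

Lemma meeting_mirror L1 L2 K1 K2 :
  meeting_property L1 L2 K1 (- K2) -> meeting_property L1 L2 K1 K2.
Proof.
move=> mp X Y wX wY XL YL p p' u v u' v' e1 e2 K pp uv pp' uv' lv Xe Ye.
have Yopp t e E : (forall t, Y (t + e) = Y t + E) -> - Y (- (t - e)) = - Y (- t) - E.
  by move=> YE; rewrite (_ : - (t - e) = - t + e) ?YE; lia.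
have [] := mp (fun t => - X t) (fun t => - Y (- t)) (walk_opp wX) (walk_rotate wY)
  _ _ (mirror p) (mirror p') (- u) v (- u') v' (- e1) e2 (- K)
  (mirror_contour pp) _ (mirror_contour pp') _.
- by move=> t; rewrite XL; lia.
- move=> t; have := Yopp (t + L1) L1 K1 YL.
  have -> : t + L1 - L1 = t by lia.
  lia.
- by case=> u0 v0; apply: uv; congr pair; lia.
- by case=> u0 v0; apply: uv'; congr pair; lia.
- by move: lv; rewrite /level /mirror /= !Z.opp_involutive; lia.
- by move=> t; rewrite Xe; lia.
- by move=> t; rewrite Z.add_opp_r (Yopp _ _ _ Ye); lia.
move=> uK [r [r' prr]]; split; first by nia.
exists r, r'; move: prr; rewrite /mirror; case: (p' r') => x y [/= hx hy].
by congr pair; lia.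
Qed.

Definition transpose (p : nat -> Z * Z) (r : nat) := ((p r).2, (p r).1).

Lemma transpose_contour X Y L1 L2 p u v : periodic_contour X Y L1 L2 p u v ->
  periodic_contour Y X L2 L1 (transpose p) v u.
Proof.
move=> [[pS [k p0]] [n pn]]; split; [split|].
- move=> r; have [a [b [ha hb pr Xb Ya]]] := pS r; exists b, a.
  by rewrite /transpose pr /=; split=> //; lia.
- by exists k; rewrite /transpose /=; lia.
- by exists n => r; rewrite /transpose pn.
Qed.

Lemma meeting_transpose L1 L2 K1 K2 : K2 <> 0 ->
  meeting_property L2 L1 K2 K1 -> meeting_property L1 L2 K1 K2.
Proof.
move=> K2n mp X Y wX wY XL YL p p' u v u' v' e1 e2 K pp uv pp' uv' lv Xe Ye.
have [] := mp Y X wY wX YL XL (transpose p) (transpose p') v u v' u' e2 e1 K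
  (transpose_contour pp) _ (transpose_contour pp') _ _ Ye Xe.
- by case=> v0 u0; apply: uv; rewrite v0 u0.
- by case=> v0 u0; apply: uv'; rewrite v0 u0.
- by move: lv; rewrite /level /transpose /=; lia.
move=> vK [r [r' prr]]; split.
  have sl := drift_slope XL YL pp.
  (* By the slope relation, v K1 and u K2 have the same sign. *)
  have eq : (v * K1) * (K2 * K2) = (u * K2) * (K1 * K1).
    rewrite (_ : _ * _ = (v * K2) * (K1 * K2)); last lia.
    by rewrite sl; lia.
  have : 0 < K2 * K2 by nia.
  have : 0 <= K1 * K1 by nia.
  nia.
exists r, r'; move: prr; rewrite /transpose; case: (p' r') => x y [/= hx hy].
by congr pair; lia.
Qed.

Lemma contour_meeting L1 L2 K1 K2 : 0 < L1 -> 0 < L2 -> K1 <> 0 -> K2 <> 0 ->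
  meeting_property L1 L2 K1 K2.
Proof.
move=> L1p L2p K1n K2n.
have neg L L' K K' : 0 < L -> 0 < L' -> 0 < K -> K' < 0 -> meeting_property L L' K K'.
  by move=> *; apply: meeting_mirror; apply: meeting_pos; lia.
have [[k1 k2]|[[k1 k2]|[[k1 k2]|[k1 k2]]]] :
  (0 < K1 /\ 0 < K2) \/ (0 < K1 /\ K2 < 0) \/ (K1 < 0 /\ 0 < K2) \/ (K1 < 0 /\ K2 < 0)
  by lia.
- exact: meeting_pos.
- exact: neg.
- by apply: meeting_transpose => //; apply: neg.
- by apply: meeting_mirror; apply: meeting_transpose; [lia | apply: neg; lia].
Qed.

End AnyDrift.

(** * Level curves when X has no drift *)

Section NoDrift.

Local Open Scope Z_scope.

Lemma periodic_max W L : 0 < L -> (forall t, W (t + L) = W t) ->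
  exists t, forall t', W t' <= W t.
Proof.
move=> L0 WL.
have [t maxt] : exists t, forall i, 0 <= i < L -> W i <= W t.
  have -> : L = Z.of_nat (Z.to_nat L) by lia.
  elim: (Z.to_nat L) => [|n [t maxt]]; first by exists 0; lia.
  have [le|le] : W (Z.of_nat n) <= W t \/ W t <= W (Z.of_nat n) by lia.
    exists t => i i_n; have [->//|lt] : i = Z.of_nat n \/ i < Z.of_nat n by lia.
    by apply: maxt; lia.
  exists (Z.of_nat n) => i i_n; have [->|lt] : i = Z.of_nat n \/ i < Z.of_nat n by lia.
    lia.
  by have := maxt i; lia.
exists t => t'; have WL0 s : W (s + L) = W s + 0 by rewrite WL; lia.
have := maxt (t' mod L) (Z.mod_pos_bound t' L L0).
suff -> : W t' = W (t' mod L) by [].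
have -> : W t' = W (t' mod L + (t' / L) * L).
  by congr W; have := Z.div_mod t' L; lia.
by rewrite (drift_iter WL0); lia.
Qed.

Lemma periodic_min W L : 0 < L -> (forall t, W (t + L) = W t) ->
  exists t, forall t', W t <= W t'.
Proof.
move=> L0 WL; have [|t maxt] := @periodic_max (fun t => - W t) L L0.
  by move=> t; rewrite WL.
by exists t => t'; have := maxt t'; lia.
Qed.

Lemma unit_steps_ivt (f : nat -> Z) t (j : nat) :
  (forall r, f (S r) = f r + 1 \/ f (S r) = f r - 1) ->
  (f O <= t <= f j) \/ (f j <= t <= f O) -> exists r, f r = t.
Proof.
move=> fS; elim: j => [|j IHj] tj; first by exists O; lia.
have [e|ne] : f (S j) = t \/ f (S j) <> t by lia.
  by exists (S j).
by apply: IHj; have := fS j; lia.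
Qed.

Lemma unit_steps_avoid (f : nat -> Z) c :
  (forall r, f (S r) = f r + 1 \/ f (S r) = f r - 1) ->
  (forall r, f r <> c) -> (forall r, f r < c) \/ (forall r, c < f r).
Proof.
move=> fS fc; have [lt|lt] : f O < c \/ c < f O by have := fc O; lia.
  by left; elim=> // r IHr; have := fc (S r); have := fS r; lia.
by right; elim=> // r IHr; have := fc (S r); have := fS r; lia.
Qed.

Variables (X Y : Z -> Z) (L1 L2 : Z).
Hypotheses (wX : walk X) (wY : walk Y) (L1p : 0 < L1) (L2p : 0 < L2).
Hypothesis XL : forall t, X (t + L2) = X t.

Lemma contour_steps p : contour X Y p ->
  (forall r, (p (S r)).1 = (p r).1 + 1 \/ (p (S r)).1 = (p r).1 - 1) /\
  (forall r, (p (S r)).2 = (p r).2 + 1 \/ (p (S r)).2 = (p r).2 - 1).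
Proof.
move=> [pS _]; split=> r; have [a [b [ha hb -> _ _]]] := pS r.
  by case: ha => ->; rewrite /=; lia.
by case: hb => ->; rewrite /=; lia.
Qed.

(* An extremum of X sits at a corner, hence faces a straight piece of Y, on one
   side of which the level is no longer attained by X. *)
Lemma contour_turns_back p r : contour X Y p ->
  (forall t, X t <= X (p r).2) \/ (forall t, X (p r).2 <= X t) ->
  (forall i, (p i).1 <= (p r).1) \/ (forall i, (p r).1 <= (p i).1).
Proof.
move=> cp ext; have [steps _] := contour_steps cp.
have lvr := contour_level cp r.
have [c [hc Xc]] : exists c, (c = (p r).1 + 1 \/ c = (p r).1 - 1) /\
    forall i, X (p i).2 <> Y c + level X Y (p O).
  have [k odd_r] := contour_odd cp r.
  have [[j tE]|[j tE]] := Z.Even_or_Odd (p r).2.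
    case: (wX) => X1 X2.
    have := X2 j; have := X1 (p r).2; have := walk_pred (p r).2 wX.
    by rewrite -tE; case: ext => ext; have := ext ((p r).2 + 1); have := ext ((p r).2 - 1); lia.
  have sE : (p r).1 = 2 * (k - j) by lia.
  case: (wY) => Y1 Y2; have := Y2 (k - j); have := Y1 (p r).1.
  rewrite -sE; rewrite /level in lvr *; case: ext => ext Y1r Y2r.
    have [up|down] : Y ((p r).1 + 1) = Y (p r).1 + 1 \/ Y ((p r).1 - 1) = Y (p r).1 + 1 by lia.
      by exists ((p r).1 + 1); split=> [|i]; [lia | rewrite up; have := ext (p i).2; lia].
    by exists ((p r).1 - 1); split=> [|i]; [lia | rewrite down; have := ext (p i).2; lia].
  have [up|down] : Y ((p r).1 + 1) = Y (p r).1 - 1 \/ Y ((p r).1 - 1) = Y (p r).1 - 1 by lia.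
    by exists ((p r).1 + 1); split=> [|i]; [lia | rewrite up; have := ext (p i).2; lia].
  by exists ((p r).1 - 1); split=> [|i]; [lia | rewrite down; have := ext (p i).2; lia].
have [i e|lt|lt] := unit_steps_avoid (c := c) steps.
- by case: (Xc i); have := contour_level cp i; rewrite /level e; lia.
- by left=> i; have := lt i; have := lt r; lia.
- by right=> i; have := lt i; have := lt r; lia.
Qed.

(* Otherwise r1, r2, r3 would give three distinct ends of the interval of columns
   visited by the curve. *)
Lemma contour_same_column p r1 r2 r3 : contour X Y p ->
  (forall t, X t <= X (p r1).2) -> (forall t, X t <= X (p r2).2) ->
  (forall t, X (p r3).2 <= X t) -> (p r1).1 = (p r2).1.
Proof.
move=> cp max1 max2 min3.
have [//|lt] : (p r1).1 = (p r2).1 \/ (p r1).1 <> (p r2).1 by lia.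
have lv1 := contour_level cp r1; have lv2 := contour_level cp r2.
have lv3 := contour_level cp r3; rewrite /level in lv1 lv2 lv3.
have X13 : X (p r3).2 < X (p r1).2.
  case: wX => /(_ 0); have := max1 0; have := max1 (0 + 1).
  by have := min3 0; have := min3 (0 + 1); lia.
have X12 : X (p r1).2 = X (p r2).2 by have := max1 (p r2).2; have := max2 (p r1).2; lia.
have ne13 : (p r1).1 <> (p r3).1 by move=> e; rewrite e in lv1; lia.
have ne23 : (p r2).1 <> (p r3).1 by move=> e; rewrite e in lv2; lia.
have := contour_turns_back cp (or_introl max1).
have := contour_turns_back cp (or_introl max2).
have := contour_turns_back cp (or_intror min3).
case=> h3; case=> h2; case=> h1; have := h3 r1; have := h3 r2; have := h2 r1;
  have := h2 r3; have := h1 r2; have := h1 r3; lia.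
Qed.

Lemma contour_visits_rows p u v : periodic_contour X Y L1 L2 p u v -> v <> 0 ->
  forall t, exists l0, forall l, l0 <= l -> exists r, (p r).2 = t + l * Z.sgn v * L2.
Proof.
move=> [cp [n pn]] v0 t; have [_ steps] := contour_steps cp.
(* From this l on, the row lies ahead of the starting point in the direction of v; the m periods
   below suffice to reach or pass it, and unit steps skip no row. *)
exists (Z.abs (t - (p O).2)) => l le_l.
pose m := Z.to_nat (l + Z.abs (t - (p O).2)).
apply: (unit_steps_ivt (j := (m * n)%N) steps).
rewrite (drift_path pn) /=.
have -> : Z.of_nat m = l + Z.abs (t - (p O).2) by rewrite Z2Nat.id; lia.
have lL : l <= l * L2 by nia.
have [v1|v1] : 0 < v \/ v < 0 by lia.
  rewrite Z.sgn_pos // Z.mul_1_r; left; split; first lia.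
  suff : (l + Z.abs (t - (p O).2)) * L2 <= (l + Z.abs (t - (p O).2)) * (v * L2) by nia.
  by apply: Z.mul_le_mono_nonneg_l; nia.
rewrite Z.sgn_neg //; right; split; last lia.
suff : (l + Z.abs (t - (p O).2)) * L2 <= (l + Z.abs (t - (p O).2)) * (- v * L2) by nia.
by apply: Z.mul_le_mono_nonneg_l; nia.
Qed.

(** The curve visits rows one period apart at which X is maximal, and it does so in a single column.
    The same lemma applied to a visit and its image after a full period gives u = 0. *)
Lemma contour_primitive p u v : periodic_contour X Y L1 L2 p u v -> v <> 0 ->
  u = 0 /\ exists r r', p r' = ((p r).1, (p r).2 + L2).
Proof.
move=> pp v0; have vis := contour_visits_rows pp v0; case: pp => cp [n pn].
have XL0 t : X (t + L2) = X t + 0 by rewrite XL; lia.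
have [t0 max0] := periodic_max L2p XL; have [t1 min1] := periodic_min L2p XL.
have [l0 vis0] := vis t0; have [l1 vis1] := vis t1.
have [r3 r3E] := vis1 l1 (Z.le_refl _).
have [r1 r1E] := vis0 l0 (Z.le_refl _).
have [|r2 r2E] := vis0 (l0 + 1); first lia.
have Xl t l : X (t + l * Z.sgn v * L2) = X t by rewrite (drift_iter XL0); lia.
have max_1 t : X t <= X (p r1).2 by rewrite r1E Xl.
have max_2 t : X t <= X (p r2).2 by rewrite r2E Xl.
have min_3 t : X (p r3).2 <= X t by rewrite r3E Xl.
have e12 := contour_same_column cp max_1 max_2 min_3.
split.
  have max_n t : X t <= X (p (r1 + n)%N).2.
    by rewrite pn /= (drift_iter XL0) Z.mul_0_r Z.add_0_r.
  have := contour_same_column cp max_1 max_n min_3.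
  rewrite pn /=; nia.
have [v1|v1] : 0 < v \/ v < 0 by lia.
  exists r1, r2; rewrite [LHS]surjective_pairing r2E r1E e12 Z.sgn_pos //.
  by congr pair; lia.
exists r2, r1; rewrite [LHS]surjective_pairing r2E r1E e12 Z.sgn_neg //.
by congr pair; lia.
Qed.

End NoDrift.

(** * Cycles of permutations *)

Section Permutations.

Lemma porbit_fixed_dvdn (T : finType) (s : {perm T}) (v : T) (m : nat) :
  ((s ^+ m)%g v == v) = (#|porbit s v| %| m).
Proof.
set n := #|porbit s v|; have n0 : 0 < n by rewrite lt0n card_porbit_neq0.
have sn q : iter (q * n) s v = v.
  by elim: q => // q IHq; rewrite mulSn iterD IHq iter_porbit.
rewrite permX {1}(divn_eq m n) addnC iterD sn /dvdn.
have := uniq_traject_porbit s v; rewrite -/n.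
case: (m %% n) (ltn_pmod m n0) => [|r] rn Ut; first by rewrite !eqxx.
have := nth_uniq v (i := r.+1) (j := 0) _ _ Ut.
by rewrite !size_traject !nth_traject // => /(_ rn n0).
Qed.

(** On D the map g factors through f. *)
Lemma leq_card_imset (A B C : finType) (f : A -> B) (g : A -> C) (D : {set A}) :
  {in D &, forall a b, f a = f b -> g a = g b} -> #|g @: D| <= #|f @: D|.
Proof.
move=> fg; have [->|/set0Pn[a0 _]] := eqVneq D set0; first by rewrite !imset0 !cards0.
pose h b := if [pick a in D | f a == b] is Some a then g a else g a0.
have -> : g @: D = h @: (f @: D); last exact: leq_imset_card.
rewrite -imset_comp; apply: eq_in_imset => a aD; rewrite /h /=.
case: pickP => [a' /andP[a'D /eqP e]|/(_ a)]; last by rewrite aD eqxx.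
exact/esym/fg.
Qed.

(** Serves to count cycles by an invariant that separates them. *)
Lemma card_imset_same_fibers (A B C : finType) (f : A -> B) (g : A -> C) (D : {set A}) :
  {in D &, forall a b, (f a == f b) = (g a == g b)} -> #|f @: D| = #|g @: D|.
Proof.
move=> fg; apply/eqP; rewrite eqn_leq.
by apply/andP; split; apply: leq_card_imset => a b aD bD /eqP e; apply/eqP;
  move: e; rewrite fg.
Qed.

Lemma sum_porbits (T : finType) (s : {perm T}) (R : nmodType) (f : T -> R) :
  (\sum_(O in porbits s) \sum_(u in O) f u = \sum_u f u)%R.
Proof.
rewrite (partition_big (porbit s) (mem (porbits s))) => [|u _]; last exact: imset_f.
apply: eq_bigr => _ /imsetP[v _ ->]; apply: eq_bigl => u.
by rewrite eq_sym eq_porbit_mem porbit_sym.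
Qed.

Lemma sum_porbit_iter (T : finType) (s : {perm T}) (R : nmodType) (f : T -> R) v :
  (\sum_(u in porbit s v) f u = \sum_(0 <= i < #|porbit s v|) f (iter i s v))%R.
Proof.
rewrite (eq_bigl _ _ (porbit_traject s v)) -big_uniq ?uniq_traject_porbit //=.
have -> : traject s v #|porbit s v| = [seq iter i s v | i <- index_iota 0 #|porbit s v|].
  apply: (@eq_from_nth _ v); first by rewrite size_traject size_map size_iota subn0.
  move=> i; rewrite size_traject => lt_i; rewrite nth_traject //.
  by rewrite (nth_map 0) ?size_iota ?subn0 // nth_iota ?subn0.
by rewrite big_map.
Qed.

Lemma card_porbits_conj (T U : finType) (s : {perm T}) (t : {perm U}) (f : T -> U) :
  bijective f -> (forall v, f (s v) = t (f v)) -> #|porbits s| = #|porbits t|.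
Proof.
move=> [g fK gK] fs.
have fX m v : f ((s ^+ m)%g v) = (t ^+ m)%g (f v).
  by elim: m v => [|m IHm] v; rewrite ?expg0 ?perm1 // !expgS !permM IHm fs.
have -> : #|porbits t| = #|(fun v => porbit t (f v)) @: [set: T]|.
  congr #|pred_of_set _|; apply/setP => O; apply/imsetP/imsetP => -[u _ ->].
    by exists (g u); rewrite ?gK.
  by exists (f u).
rewrite -(card_imset_same_fibers (f := porbit s)); last first.
  move=> u v _ _; rewrite !eq_porbit_mem.
  apply/porbitP/porbitP => -[m e]; exists m; first by rewrite e fX.
  by apply: (can_inj fK); rewrite fX.
by apply: eq_card => O; apply/imsetP/imsetP => -[u _ ->]; exists u.
Qed.

End Permutations.

(** * Lifting patterns to the plane *)

Section Reduction.

Local Open Scope ring_scope.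

Definition red (n : nat) (a : Z) : 'Z_n := (int_of_Z a)%:~R.

Lemma redD n a b : red n (a + b)%zz = red n a + red n b.
Proof. by rewrite /red -intrD; congr (_%:~R); lia. Qed.

Lemma red_int n (a : int) : red n (Z_of_int a) = a%:~R.
Proof. by rewrite /red Z_of_intK. Qed.

Lemma red_nat n (a : nat) : red n (Z.of_nat a) = a%:R.
Proof. by rewrite /red (_ : int_of_Z _ = a%:Z) //; lia. Qed.

Lemma red_period n (e : Z) : (1 < n)%N -> red n (e * Z.of_nat n)%zz = 0.
Proof.
move=> n1; rewrite /red (_ : int_of_Z _ = int_of_Z e * n%:Z); last by lia.
by rewrite intrM -pmulrn pchar_Zp // mulr0.
Qed.

Lemma red_eq n (a b : Z) : (1 < n)%N -> red n a = red n b ->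
  exists e, b = (a + e * Z.of_nat n)%zz.
Proof.
move=> n1 ab; have r0 : red n (b - a)%zz = 0.
  by apply: (addrI (red n a)); rewrite -redD addr0 ab; congr (red n _); lia.
pose r := ((b - a) mod Z.of_nat n)%zz.
have rn : (0 <= r < Z.of_nat n)%zz by apply: Z.mod_pos_bound; lia.
have bE := Z.div_mod (b - a) (Z.of_nat n).
have {}r0 : red n r = 0.
  rewrite -r0 [in RHS]bE; last lia.
  by rewrite redD Z.mul_comm red_period // add0r.
exists ((b - a) / Z.of_nat n)%zz; suff : r = 0%zz by rewrite /r; lia.
have rE : r = Z.of_nat (Z.to_nat r) by lia.
move: r0; rewrite rE red_nat => /(congr1 val) /=.
rewrite val_Zp_nat // modn_small; lia.
Qed.

Lemma red_surj n (i : 'Z_n) : red n (Z.of_nat i) = i.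
Proof. by rewrite red_nat natr_Zp. Qed.

End Reduction.

(** * Walks with given increments *)

Section Primitive.

Local Open Scope Z_scope.

Fixpoint sumZ (f : Z -> Z) (a : Z) (n : nat) : Z :=
  if n is S n' then sumZ f a n' + f (a + Z.of_nat n') else 0.

(** The discrete antiderivative that vanishes at 0. [Z.to_nat] is 0 on negative numbers, so at least
    one of the two sums is empty. *)
Definition primitive (f : Z -> Z) (t : Z) : Z :=
  sumZ f 0 (Z.to_nat t) - sumZ f t (Z.to_nat (- t)).

Lemma sumZ_recl f a n : sumZ f a (S n) = f a + sumZ f (a + 1) n.
Proof.
have sumS m b : sumZ f b (S m) = sumZ f b m + f (b + Z.of_nat m) by [].
elim: n => [|n IHn]; first by rewrite /= Z.add_0_r; lia.
rewrite sumS IHn sumS (_ : a + Z.of_nat n.+1 = a + 1 + Z.of_nat n); lia.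
Qed.

Lemma primitiveS f t : primitive f (t + 1) = primitive f t + f t.
Proof.
rewrite /primitive; have [le|lt] : 0 <= t \/ t < 0 by lia.
  rewrite (_ : Z.to_nat (t + 1) = S (Z.to_nat t)); last lia.
  rewrite (_ : Z.to_nat (- (t + 1)) = O); last lia.
  rewrite (_ : Z.to_nat (- t) = O); last lia.
  by rewrite /= Z2Nat.id // Z.add_0_l; lia.
rewrite (_ : Z.to_nat (t + 1) = O); last lia.
rewrite (_ : Z.to_nat t = O); last lia.
rewrite (_ : Z.to_nat (- t) = S (Z.to_nat (- (t + 1)))); last lia.
by rewrite sumZ_recl; lia.
Qed.

(** The increase over a period does not depend on where the period starts, so it can be computed
    from 0. *)
Lemma primitive_drift f (L : nat) : (forall t, f (t + Z.of_nat L) = f t) ->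
  forall t, primitive f (t + Z.of_nat L) = primitive f t + sumZ f 0 L.
Proof.
move=> fL; have posE (n : nat) t : primitive f (t + Z.of_nat n + Z.of_nat L) -
    primitive f (t + Z.of_nat n) = primitive f (t + Z.of_nat L) - primitive f t.
  elim: n => [|n IHn]; first by rewrite Z.add_0_r.
  rewrite (_ : t + Z.of_nat n.+1 = t + Z.of_nat n + 1); last lia.
  rewrite -[in LHS]Z.add_assoc (Z.add_comm 1) Z.add_assoc !primitiveS fL; lia.
have p0 : primitive f (0 + Z.of_nat L) - primitive f 0 = sumZ f 0 L.
  rewrite /primitive Z.add_0_l Nat2Z.id (_ : Z.to_nat (- Z.of_nat L) = O); last lia.
  by rewrite /=; lia.
move=> t; have [le|lt] : 0 <= t \/ t < 0 by lia.
  by have := posE (Z.to_nat t) 0; rewrite Z2Nat.id // Z.add_0_l; lia.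
have := posE (Z.to_nat (- t)) t; rewrite Z2Nat.id; last lia.
by rewrite Z.add_opp_diag_r; lia.
Qed.

(** Time and altitude are both doubled: time 2 j is the midpoint of the step of W from j to j + 1,
    with altitude W j + W (j + 1), and time 2 j + 1 is the end of that step. *)
Definition double (W : Z -> Z) (t : Z) : Z := W (t / 2 + 1) + W ((t + 1) / 2).

Lemma double_even W j : double W (2 * j) = W j + W (j + 1).
Proof.
rewrite /double (_ : 2 * j / 2 = j); last by rewrite Z.mul_comm Z.div_mul.
rewrite (_ : (2 * j + 1) / 2 = j); first lia.
by rewrite Z.mul_comm Z.div_add_l // Z.add_0_r.
Qed.

Lemma double_odd W j : double W (2 * j + 1) = 2 * W (j + 1).
Proof.
rewrite /double (_ : (2 * j + 1) / 2 = j); last by rewrite Z.mul_comm Z.div_add_l // Z.add_0_r.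
rewrite (_ : (2 * j + 1 + 1) / 2 = j + 1); first lia.
by rewrite (_ : 2 * j + 1 + 1 = (j + 1) * 2) ?Z.div_mul //; lia.
Qed.

Lemma walk_double W : (forall t, W (t + 1) = W t + 1 \/ W (t + 1) = W t - 1) ->
  walk (double W).
Proof.
move=> W1; split=> t.
  have [[j ->]|[j ->]] := Z.Even_or_Odd t.
    by rewrite double_even double_odd; have := W1 j; lia.
  rewrite (_ : 2 * j + 1 + 1 = 2 * (j + 1)); last lia.
  by rewrite double_even double_odd; have := W1 (j + 1); lia.
have := double_odd W (t - 1); rewrite (_ : 2 * (t - 1) + 1 = 2 * t - 1); last lia.
rewrite (_ : t - 1 + 1 = t); last lia.
by rewrite double_even double_odd; lia.
Qed.

Lemma double_drift W L K : (forall t, W (t + L) = W t + K) ->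
  forall t, double W (t + 2 * L) = double W t + 2 * K.
Proof.
move=> WL t; have [[j ->]|[j ->]] := Z.Even_or_Odd t.
  rewrite (_ : 2 * j + 2 * L = 2 * (j + L)); last lia.
  rewrite !double_even (_ : j + L + 1 = j + 1 + L) ?WL; lia.
rewrite (_ : 2 * j + 1 + 2 * L = 2 * (j + L) + 1); last lia.
rewrite !double_odd (_ : j + L + 1 = j + 1 + L) ?WL; lia.
Qed.

End Primitive.

Lemma Z_of_intD a b : Z_of_int (a + b)%R = (Z_of_int a + Z_of_int b)%zz.
Proof. exact: rmorphD. Qed.

Definition sgn_fun (n : nat) (x : 'Z_n -> int) : Prop :=
  forall i, (x i = 1 \/ x i = -1)%R.

Definition lift (n : nat) (x : 'Z_n -> int) (t : Z) : Z := Z_of_int (x (red n t)).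

Lemma lift_period n (x : 'Z_n -> int) : 1 < n ->
  forall t, lift x (t + Z.of_nat n)%zz = lift x t.
Proof.
by move=> n1 t; rewrite /lift redD -(Z.mul_1_l (Z.of_nat n)) red_period // addr0.
Qed.

Lemma sumZ_lift n (x : 'Z_n -> int) : 1 < n ->
  sumZ (lift x) 0 n = Z_of_int (\sum_i x i)%R.
Proof.
move=> n1; have sumE m : sumZ (lift x) 0 m = Z_of_int (\sum_(i < m) x (i%:R))%R.
  elim: m => [|m IHm]; first by rewrite big_ord0.
  by rewrite big_ord_recr /= IHm /lift Z.add_0_l red_nat rmorphD.
have -> : sumZ (lift x) 0 n = sumZ (lift x) 0 (Zp_trunc n).+2 by rewrite Zp_cast.
rewrite sumE.
by congr Z_of_int; apply: eq_bigr => i _; rewrite natr_Zp.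
Qed.

Definition height (n : nat) (x : 'Z_n -> int) : Z -> Z := double (primitive (lift x)).

Lemma walk_height n (x : 'Z_n -> int) : sgn_fun x -> walk (height x).
Proof.
move=> sx; apply: walk_double => t; rewrite primitiveS /lift.
have := sx (red n t); lia.
Qed.

Lemma height_drift n (x : 'Z_n -> int) : 1 < n -> forall t,
  height x (t + 2 * Z.of_nat n)%zz = (height x t + 2 * Z_of_int (\sum_i x i)%R)%zz.
Proof.
move=> n1; apply: double_drift; rewrite -sumZ_lift //.
exact: primitive_drift (lift_period x n1).
Qed.

Lemma height_at n (x : 'Z_n -> int) t (b : Z) : sgn_fun x -> (b = 1 \/ b = -1)%zz ->
  (height x (2 * t + b) = height x (2 * t) + b * lift x t)%zz.
Proof.
move=> sx; rewrite /height double_even primitiveS => -[->|->].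
  by rewrite double_odd primitiveS; lia.
rewrite (_ : 2 * t + -1 = 2 * (t - 1) + 1)%zz; last lia.
by rewrite double_odd (_ : t - 1 + 1 = t)%zz; lia.
Qed.

(** * The turn permutation and its lift *)

Section Turn.

Local Open Scope ring_scope.

Variables (M N : nat) (x : 'Z_N -> int) (y : 'Z_M -> int).

Definition hstep (v : 'Z_M * 'Z_N) : 'Z_M * 'Z_N := (v.1 + (x v.2)%:~R, v.2).
Definition vstep (v : 'Z_M * 'Z_N) : 'Z_M * 'Z_N := (v.1, v.2 + (y v.1)%:~R).

Lemma hstepK : cancel hstep (fun v => (v.1 - (x v.2)%:~R, v.2)).
Proof. by case=> i j; rewrite /hstep /= addrK. Qed.

Lemma vstepK : cancel vstep (fun v => (v.1, v.2 - (y v.1)%:~R)).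
Proof. by case=> i j; rewrite /vstep /= addrK. Qed.

Definition hperm : {perm 'Z_M * 'Z_N} := perm (can_inj hstepK).
Definition vperm : {perm 'Z_M * 'Z_N} := perm (can_inj vstepK).
Definition turn : {perm 'Z_M * 'Z_N} := (hperm * vperm)%g.

Lemma turnE v : turn v = vstep (hstep v).
Proof. by rewrite permM !permE. Qed.

Definition turnZ (w : Z * Z) : Z * Z :=
  (w.1 + lift x w.2, w.2 + lift y (w.1 + lift x w.2))%zz.

Definition red2 (w : Z * Z) : 'Z_M * 'Z_N := (red M w.1, red N w.2).

Lemma red2_turnZ w : red2 (turnZ w) = turn (red2 w).
Proof. by rewrite turnE /red2 /turnZ /vstep /hstep /= !redD /lift !red_int redD red_int. Qed.

Lemma red2_iter m w : red2 (iter m turnZ w) = iter m turn (red2 w).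
Proof. by elim: m => //= m IHm; rewrite red2_turnZ IHm. Qed.

Definition translate (e f : Z) (w : Z * Z) : Z * Z :=
  (w.1 + e * Z.of_nat M, w.2 + f * Z.of_nat N)%zz.

(** The pair of displacements of the loop. The vertical edge that follows the horizontal edge at u
    lies in the column of [turn u], but [turn] permutes O, so y can be summed over u itself. *)
Definition orbit_class (O : {set 'Z_M * 'Z_N}) : int * int :=
  (\sum_(u in O) x u.2, \sum_(u in O) y u.1).

Lemma iter_turnZ_class w : let v := red2 w in
  iter #|porbit turn v| turnZ w =
    (w.1 + Z_of_int (orbit_class (porbit turn v)).1,
     w.2 + Z_of_int (orbit_class (porbit turn v)).2)%zz.
Proof.
move=> v; rewrite /orbit_class /= (sum_porbit_iter turn (fun u => x u.2)).
rewrite [\sum_(u in _) y _](_ : _ = \sum_(u in porbit turn v) y (turn u).1); last first.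
  rewrite (reindex_inj (@perm_inj _ turn)); apply: eq_bigl => u.
  by rewrite -!eq_porbit_mem -(porbit_perm turn 1) expg1.
rewrite (sum_porbit_iter turn (fun u => y (turn u).1)).
elim: #|_| => [|n IHn]; first by rewrite !big_geq //= !Z.add_0_r; case: (w).
rewrite !big_nat_recr //= !Z_of_intD.
have -> : iter n turn v = red2 (iter n turnZ w) by rewrite red2_iter.
move: IHn; rewrite -red2_turnZ; case: (iter n turnZ w) => s t [-> ->].
by rewrite !Z.add_assoc.
Qed.

Hypotheses (M1 : (1 < M)%N) (N1 : (1 < N)%N) (sx : sgn_fun x) (sy : sgn_fun y).

Lemma red2_translate e f w : red2 (translate e f w) = red2 w.
Proof. by rewrite /red2 /translate /= !redD !red_period // !addr0; case: w. Qed.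

Lemma turnZ_translate e f w : turnZ (translate e f w) = translate e f (turnZ w).
Proof.
have liftE n (z : 'Z_n -> int) a b :
    (1 < n)%N -> lift z (a + b * Z.of_nat n)%zz = lift z a.
  by move=> n1; rewrite /lift redD red_period ?addr0.
rewrite /turnZ /translate /= liftE //; congr pair; first lia.
rewrite (_ : w.1 + e * Z.of_nat M + lift x w.2 = w.1 + lift x w.2 + e * Z.of_nat M)%zz; last lia.
rewrite liftE //; lia.
Qed.

Lemma iter_turnZ_translate m e f w :
  iter m turnZ (translate e f w) = translate e f (iter m turnZ w).
Proof. by elim: m => //= m ->; rewrite turnZ_translate. Qed.

Lemma red2_eq w w' : red2 w = red2 w' -> exists e f, w' = translate e f w.
Proof.
case: w w' => s t [s' t'] [/(red_eq M1)[e ->] /(red_eq N1)[f ->]].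
by exists e, f.
Qed.

(** After one cycle a lift returns to a point with the same reduction. All lifts of v are translates
    of one of them and [turnZ] commutes with translations, so (p, q) is the same for all. *)
Lemma orbit_class_lattice v : exists p q : Z,
  (forall w, red2 w = v -> iter #|porbit turn v| turnZ w = translate p q w) /\
  orbit_class (porbit turn v) = (int_of_Z p * M%:Z, int_of_Z q * N%:Z).
Proof.
pose w : Z * Z := (Z.of_nat v.1, Z.of_nat v.2).
have vE : red2 w = v by rewrite /red2 /= !red_surj; case: (v).
have [p [q pq]] : exists p q, iter #|porbit turn v| turnZ w = translate p q w.
  by apply: red2_eq; rewrite red2_iter vE iter_porbit.
exists p, q; split.
  move=> w'; rewrite -vE => /esym/red2_eq[e [f ->]].
  rewrite vE iter_turnZ_translate pq /translate /=; congr pair; lia.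
move: (iter_turnZ_class w); rewrite vE /= pq => -[].
rewrite /translate /= => /Z.add_reg_l h1 /Z.add_reg_l h2.
by congr pair; [rewrite -[LHS]Z_of_intK -h1 | rewrite -[LHS]Z_of_intK -h2]; lia.
Qed.

(** Points of one lifted curve with the same reduction are a whole number j of cycles apart. *)
Lemma translate_iter_multiple v w m m' e f p q :
  red2 w = v -> iter #|porbit turn v| turnZ w = translate p q w ->
  iter m' turnZ w = translate e f (iter m turnZ w) ->
  exists j, e = (j * p)%zz /\ f = (j * q)%zz.
Proof.
move=> vE pq; wlog le_m : m m' e f / (m <= m')%N.
  move=> wl mm; have [le|/ltnW le] := leqP m m'; first exact: wl le mm.
  have [|j [e_j f_j]] := wl m' m (- e)%zz (- f)%zz le; last by exists (- j)%zz; lia.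
  by rewrite mm /translate /=; case: (iter m turnZ w) => s t /=; congr pair; lia.
rewrite -(subnKC le_m) addnC iterD => mm.
have [j jE] : exists j : nat, (m' - m = j * #|porbit turn v|)%N.
  apply/dvdnP; rewrite -(porbit_perm turn m) -porbit_fixed_dvdn permX.
  apply/eqP; rewrite permX -vE -!red2_iter.
  by rewrite mm red2_translate.
have transl2 e1 f1 e2 f2 u : translate e1 f1 (translate e2 f2 u) =
    translate (e1 + e2)%zz (f1 + f2)%zz u.
  by rewrite /translate /=; congr pair; lia.
have pqj (i : nat) : iter (i * #|porbit turn v|) turnZ (iter m turnZ w) =
    translate (Z.of_nat i * p)%zz (Z.of_nat i * q)%zz (iter m turnZ w).
  elim: i => [|i IHi].
    by rewrite /translate /= !Z.mul_0_l !Z.add_0_r; case: (iter _ _ _).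
  rewrite mulSn iterD IHi iter_turnZ_translate -iterD addnC iterD pq.
  by rewrite iter_turnZ_translate transl2; congr translate; lia.
exists (Z.of_nat j); move: mm; rewrite jE pqj /translate => -[].
move/Z.add_reg_l/Z.mul_reg_r => -> //; last lia.
by move/Z.add_reg_l/Z.mul_reg_r => -> //; lia.
Qed.

(* The midpoints, in doubled coordinates, of the successive edges that leave w. *)
Definition turn_path (w : Z * Z) (r : nat) : Z * Z :=
  let u := iter r./2 turnZ w in let u' := iter r./2.+1 turnZ w in
  if odd r then (2 * u'.1, u.2 + u'.2)%zz else (u.1 + u'.1, 2 * u.2)%zz.

(** The parities of the coordinates of a midpoint tell horizontal edges from vertical ones, and the
    midpoint together with the sign of its row or column determines the ends of the edge. *)
Lemma turn_path_shift_inv e f w w' r r' :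
  turn_path w' r' = ((turn_path w r).1 + e * (2 * Z.of_nat M),
                    (turn_path w r).2 + f * (2 * Z.of_nat N))%zz ->
  exists m m', iter m' turnZ w' = translate e f (iter m turnZ w).
Proof.
have liftE n (z : 'Z_n -> int) a b :
    (1 < n)%N -> lift z (a + b * Z.of_nat n)%zz = lift z a.
  by move=> n1; rewrite /lift redD red_period ?addr0.
rewrite /turn_path; set u := iter r./2 _ w; set u' := iter r'./2 _ w'.
rewrite !iterS -/u -/u'.
have sgnE n (z : 'Z_n -> int) a : sgn_fun z -> (lift z a = 1 \/ lift z a = -1)%zz.
  by move=> sz; rewrite /lift; have := sz (red n a); lia.
have s_x := sgnE _ x u.2 sx; have s_x' := sgnE _ x u'.2 sx.
have s_y := sgnE _ y (u.1 + lift x u.2)%zz sy.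
have s_y' := sgnE _ y (u'.1 + lift x u'.2)%zz sy.
case: (odd r'); case: (odd r) => /= -[] h1 h2; try lia.
- exists (r./2.+1), (r'./2.+1); rewrite !iterS -/u -/u' /turnZ /translate /=.
  have e1 : (u'.1 + lift x u'.2 = u.1 + lift x u.2 + e * Z.of_nat M)%zz by lia.
  by rewrite e1 liftE // in h2 *; congr pair; lia.
exists (r./2), (r'./2); rewrite -/u -/u' [LHS]surjective_pairing /translate.
have e2 : (u'.2 = u.2 + f * Z.of_nat N)%zz by lia.
by rewrite e2 liftE // in h1 *; congr pair; lia.
Qed.

(** Between successive midpoints the path moves by the sign of the row in the first coordinate and
    by the sign of the column in the second, and these are the slopes of the two heights there. *)
Lemma turn_path_contour w : contour (height x) (height y) (turn_path w).
Proof.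
split=> [r|]; last first.
  rewrite /turn_path /=; have := sx (red N w.2); rewrite /lift => -[->|->].
    by exists (w.1 + w.2)%zz; lia.
  by exists (w.1 + w.2 - 1)%zz; lia.
have sgnE n (z : 'Z_n -> int) a : sgn_fun z -> (lift z a = 1 \/ lift z a = -1)%zz.
  by move=> sz; rewrite /lift; have := sz (red n a); lia.
rewrite /turn_path (_ : r.+1./2 = odd r + r./2)%N; last exact: uphalf_half.
rewrite oddS; case: (odd r); rewrite ?add1n ?add0n.
  rewrite !iterS; set u := iter r./2 _ _; rewrite /turnZ /=.
  set s := (u.1 + lift x u.2)%zz; set t := (u.2 + lift y s)%zz.
  have sy_s := sgnE _ y s sy; have sx_t := sgnE _ x t sx.
  exists (lift x t), (lift y s); split=> //=.
  - by congr pair; rewrite /t; lia.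
  - rewrite (_ : u.2 + t + lift y s = 2 * t)%zz; last by rewrite /t; lia.
    have -> : (u.2 + t = 2 * t + - lift y s)%zz by rewrite /t; lia.
    by rewrite (height_at _ sx); lia.
  by rewrite (height_at _ sy) //; lia.
rewrite !iterS; set u := iter r./2 _ _; rewrite /turnZ /=.
set s := (u.1 + lift x u.2)%zz.
have sy_s := sgnE _ y s sy; have sx_t := sgnE _ x u.2 sx.
exists (lift x u.2), (lift y s); split=> //=.
- by congr pair; rewrite /s; lia.
- by rewrite (height_at _ sx) //; lia.
rewrite (_ : u.1 + s + lift x u.2 = 2 * s)%zz; last by rewrite /s; lia.
have -> : (u.1 + s = 2 * s + - lift x u.2)%zz by rewrite /s; lia.
by rewrite (height_at _ sy); lia.
Qed.

Lemma turn_path_periodic w n p q : iter n turnZ w = translate p q w ->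
  periodic_contour (height x) (height y) (2 * Z.of_nat M)%zz (2 * Z.of_nat N)%zz
    (turn_path w) p q.
Proof.
move=> pq; split; first exact: turn_path_contour.
exists (n.*2)%N => r; rewrite /turn_path oddD odd_double addbF.
have -> : ((r + n.*2)./2 = n + r./2)%N by rewrite halfD odd_double andbF doubleK add0n addnC.
have iterE m : iter (n + m) turnZ w = translate p q (iter m turnZ w).
  by rewrite addnC iterD pq iter_turnZ_translate.
rewrite -addnS !iterE /translate; case: (odd r) => /=; congr pair; lia.
Qed.

End Turn.

Lemma odd_abszD (a b : int) : odd (absz (a + b)%R) = odd (absz a) (+) odd (absz b).
Proof. lia. Qed.

(** * Homology classes of the orbits *)

Section Classes.

Local Open Scope ring_scope.

Variables (M N : nat) (x : 'Z_N -> int) (y : 'Z_M -> int).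
Hypotheses (M1 : (1 < M)%N) (N1 : (1 < N)%N) (sx : sgn_fun x) (sy : sgn_fun y).

Let T := turn x y.
Let kx := Z_of_int (\sum_j x j).
Let ky := Z_of_int (\sum_i y i).

Lemma orbit_slope w n p q :
  iter n (turnZ x y) w = translate M N p q w -> (q * kx = p * ky)%zz.
Proof.
move=> pq; have pp := turn_path_periodic M1 N1 sx sy pq.
have := drift_slope (height_drift x N1) (height_drift y M1) pp; rewrite -/kx -/ky; lia.
Qed.

(** The curve meets its own translate by (a, b), so (a, b) is a multiple of (p, q). Conversely the
    slope relation makes (p, q) proportional to the primitive vector (a, b), so the two agree up to
    sign. *)
Lemma orbit_direction w p q g a b : let v := red2 M N w in
  iter #|porbit T v| (turnZ x y) w = translate M N p q w ->
  (p, q) <> (0%zz, 0%zz) ->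
  kx <> 0%zz -> ky <> 0%zz -> kx = (g * a)%zz -> ky = (g * b)%zz -> (0 < g)%zz ->
  Z.gcd a b = 1%zz -> p = a /\ q = b.
Proof.
move=> v pq pq0 kx0 ky0 kxE kyE g0 ab1.
have pp := turn_path_periodic M1 N1 sx sy pq.
have translE n (z : 'Z_n -> int) c t : (1 < n)%N ->
    height z (t + c * (2 * Z.of_nat n))%zz =
    (height z t + c * (2 * Z_of_int (\sum_i z i)))%zz.
  by move=> n1; apply: drift_iter; apply: height_drift.
have meet := @contour_meeting (2 * Z.of_nat M)%zz (2 * Z.of_nat N)%zz (2 * ky)%zz (2 * kx)%zz.
(* Shifting by a periods horizontally and b vertically raises both heights by 2 g a b. *)
have [||||||posp [r [r' rr']]] := meet _ _ _ _ _ _ (walk_height sx) (walk_height sy)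
  (height_drift x N1) (height_drift y M1) _ _ _ _ _ _
  (a * (2 * Z.of_nat M))%zz (b * (2 * Z.of_nat N))%zz (2 * g * a * b)%zz
  pp pq0 pp pq0 erefl; try lia.
- by move=> t; rewrite translE // -/kx kxE; lia.
- by move=> t; rewrite translE // -/ky kyE; lia.
have [m [m' mm']] := turn_path_shift_inv M1 N1 sx sy rr'.
have [j [aj bj]] := translate_iter_multiple M1 N1 (erefl v) pq mm'.
have sl := orbit_slope pq.
have /Z.gauss : (a | b * p)%zz.
  exists q; apply: (Z.mul_reg_l _ _ g); first lia.
  move: sl; rewrite kxE kyE; lia.
case/(_ ab1) => c pc.
have : (a * (j * c) = a * 1)%zz by rewrite {1}pc in aj; lia.
move/Z.mul_reg_l => jc; have {}jc : (j * c = 1)%zz by apply: jc; lia.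
have [j1|j1] : j = 1%zz \/ j = (-1)%zz by apply: Z.mul_eq_1; exact: jc.
  by rewrite j1 in aj bj; lia.
(* The opposite sign p = - a would make p kx = - g a a, against the direction found above. *)
exfalso; rewrite j1 in aj; move: posp; rewrite kxE.
have -> : p = (- a)%zz by lia.
have : (0 <= a * a)%zz by nia.
have : (0 < g)%zz by []; nia.
Qed.

(** If q is nonzero, the slope relation forces kx = 0; then p = 0 and the curve meets its translate
    by (0, 1), so q divides 1. The case of p follows by transposition. *)
Lemma orbit_unit w p q : let v := red2 M N w in
  iter #|porbit T v| (turnZ x y) w = translate M N p q w ->
  kx = 0%zz \/ ky = 0%zz -> (Z.abs p + Z.abs q <= 1)%zz.
Proof.
move=> v pq k0; have pp := turn_path_periodic M1 N1 sx sy pq.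
have sl := orbit_slope pq.
have multiple e f r r' : turn_path x y w r' =
    ((turn_path x y w r).1 + e * (2 * Z.of_nat M),
     (turn_path x y w r).2 + f * (2 * Z.of_nat N))%zz ->
    exists j, e = (j * p)%zz /\ f = (j * q)%zz.
  move/(turn_path_shift_inv M1 N1 sx sy) => [m [m' mm']].
  exact: (translate_iter_multiple M1 N1 (erefl v) pq mm').
have [[q0 kx0]|[[p0 ky0]|[p0 q0]]] : (q <> 0 /\ kx = 0)%zz \/ (p <> 0 /\ ky = 0)%zz
    \/ (p = 0 /\ q = 0)%zz by nia.
- have per t : height x (t + 2 * Z.of_nat N)%zz = height x t.
    by rewrite height_drift // -/kx kx0; lia.
  have [||p0 [r [r' rr']]] := contour_primitive (walk_height sx) (walk_height sy)
    _ _ per pp q0; try lia.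
  have [|j [_ jq]] := multiple 0%zz 1%zz r r'; first by rewrite rr'; congr pair; lia.
  by have := Z.mul_eq_1 j q; lia.
- have per t : height y (t + 2 * Z.of_nat M)%zz = height y t.
    by rewrite height_drift // -/ky ky0; lia.
  have [||q0 [r [r' rr']]] := contour_primitive (walk_height sy) (walk_height sx)
    _ _ per (transpose_contour pp) p0; try lia.
  have [|j [jp _]] := multiple 1%zz 0%zz r r'.
    by move: rr'; rewrite /transpose; case: (turn_path x y w r') => c d /= [-> ->]; congr pair; lia.
  by have := Z.mul_eq_1 j p; lia.
by lia.
Qed.

Definition nontrivial_orbits : {set {set 'Z_M * 'Z_N}} :=
  [set O in porbits T | orbit_class x y O != (0, 0)].

Lemma sum_orbit_class :
  \sum_(O in porbits T) (orbit_class x y O).1 = M%:Z * \sum_j x j /\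
  \sum_(O in porbits T) (orbit_class x y O).2 = N%:Z * \sum_i y i.
Proof.
rewrite /orbit_class /= !sum_porbits; split.
  rewrite -(pair_big xpredT xpredT (fun i j => x j)) /= sumr_const.
  by rewrite (_ : #|_| = M) ?card_ord ?Zp_cast // -mulr_natl natz.
rewrite -(pair_big xpredT xpredT (fun i j => y i)) /= mulr_sumr; apply: eq_bigr => i _.
by rewrite sumr_const (_ : #|_| = N) ?card_ord ?Zp_cast // -mulr_natl natz.
Qed.

(** All nontrivial cycles have the same horizontal displacement a M, and the displacements add up to
    M g a. *)
Lemma nontrivial_orbits_gcd : \sum_j x j != 0 -> \sum_i y i != 0 ->
  #|nontrivial_orbits| = gcdn (absz (\sum_j x j)) (absz (\sum_i y i)).
Proof.
move=> kx0 ky0; set g := gcdn _ _.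
have g0 : (0 < g)%N by rewrite gcdn_gt0; apply/orP; left; lia.
have [a kxE] : exists a : int, \sum_j x j = g%:Z * a.
  have /dvdzP[a aE] : (g%:Z %| \sum_j x j)%Z by rewrite dvdzE /= dvdn_gcdl.
  by exists a; rewrite aE mulrC.
have [b kyE] : exists b : int, \sum_i y i = g%:Z * b.
  have /dvdzP[b bE] : (g%:Z %| \sum_i y i)%Z by rewrite dvdzE /= dvdn_gcdr.
  by exists b; rewrite bE mulrC.
have ab1 : Z.gcd (Z_of_int a) (Z_of_int b) = 1%zz.
  have ab : coprimez a b.
    apply/eqP; have : g = (g * gcdn `|a| `|b|)%N by rewrite muln_gcdr {1}/g kxE kyE !abszM.
    by rewrite /gcdz; nia.
  have [u [v uv]] := Bezoutz a b; rewrite (eqP ab) in uv.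
  by apply: Z.bezout_1_gcd; exists (Z_of_int u), (Z_of_int v); lia.
have classE O : O \in nontrivial_orbits -> (orbit_class x y O).1 = a * M%:Z.
  rewrite inE => /andP[/imsetP[v _ ->]].
  have [p [q [pq ->]]] := orbit_class_lattice x y M1 N1 v.
  pose w : Z * Z := (Z.of_nat v.1, Z.of_nat v.2).
  have vE : red2 M N w = v by rewrite /red2 /= !red_surj; case: (v).
  move=> pq0; have := @orbit_direction w p q (Z.of_nat g) (Z_of_int a) (Z_of_int b).
  rewrite vE => /(_ (pq w vE)) dir /=.
  have [|||||||pa _] := dir => //; last by rewrite pa Z_of_intK.
  - by move=> [p0 q0]; move: pq0; rewrite p0 q0 !mul0r eqxx.
  - rewrite /kx; lia.
  - rewrite /ky; lia.
  - rewrite /kx kxE; lia.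
  - rewrite /ky kyE; lia.
  - lia.
have := sum_orbit_class.1; rewrite (bigID (fun O => orbit_class x y O != (0, 0))) /=.
rewrite [X in _ + X]big1 => [|O /andP[_]]; last by move/negPn/eqP => e; exact: (congr1 fst e).
rewrite addr0 (eq_bigl (mem nontrivial_orbits)); last by move=> O; rewrite !inE.
rewrite (eq_bigr (fun=> a * M%:Z)) => [|O /classE //].
rewrite sumr_const kxE -mulr_natl natz.
have a0 : a != 0 by apply: contraNneq kx0 => a0; rewrite kxE a0 mulr0.
rewrite mulrA mulrC => /(mulfI _) H; have {}H : #|nontrivial_orbits|%:Z * a = g%:Z * a.
  by apply: H; lia.
by move/(mulIf a0): H => [].
Qed.

Lemma sum_sgn_parity n (z : 'Z_n -> int) : (1 < n)%N -> sgn_fun z ->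
  odd (absz (\sum_i z i)) = odd n.
Proof.
move=> n1 sz; have nE : (\sum_(i : 'Z_n) 1)%N = n by rewrite sum1_card card_ord Zp_cast.
rewrite -[RHS](congr1 odd nE).
elim/big_ind2: _ => [//|a m b l|i _]; first by move=> ha hb; rewrite oddD -ha -hb odd_abszD.
by case: (sz i) => ->.
Qed.

(** If both sums are nonzero, this is the parity of their gcd. Otherwise the classes are (0, 0) or
    unit vectors up to sign, so p + q is odd exactly on the nontrivial cycles, and its total is the
    sum of all x and y. *)
Lemma odd_nontrivial_orbits : odd #|nontrivial_orbits| = odd M || odd N.
Proof.
have kxN := sum_sgn_parity N1 sx; have kyM := sum_sgn_parity M1 sy.
have [[kx0 ky0]|k0] : (\sum_j x j != 0 /\ \sum_i y i != 0) \/ (kx = 0%zz \/ ky = 0%zz).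
  by rewrite /kx /ky; lia.
  rewrite nontrivial_orbits_gcd // -[LHS]negbK -dvdn2 dvdn_gcd !dvdn2 negb_and !negbK.
  by rewrite kxN kyM orbC.
have unit O : O \in porbits T -> exists p q : int,
    orbit_class x y O = (p * M%:Z, q * N%:Z) /\ (`|p| + `|q| <= 1)%N.
  move=> /imsetP[v _ ->]; have [p [q [pq ->]]] := orbit_class_lattice x y M1 N1 v.
  exists (int_of_Z p), (int_of_Z q); split=> //.
  pose w : Z * Z := (Z.of_nat v.1, Z.of_nat v.2).
  have vE : red2 M N w = v by rewrite /red2 /= !red_surj; case: (v).
  have := @orbit_unit w p q; rewrite vE => /(_ (pq w vE) k0); lia.
pose f O : int := ((orbit_class x y O).1 %/ M%:Z)%Z + ((orbit_class x y O).2 %/ N%:Z)%Z.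
have fE O : O \in porbits T -> odd `|f O|%N = (orbit_class x y O != (0, 0)) /\
    f O * (M%:Z * N%:Z) = (orbit_class x y O).1 * N%:Z + (orbit_class x y O).2 * M%:Z.
  move=> /unit[p [q [e pq]]]; rewrite /f e /= !mulzK; [|lia|lia].
  split; last by lia.
  rewrite xpair_eqE !mulf_eq0; move: M1 N1 pq; clear; lia.
have -> : odd #|nontrivial_orbits| = odd `|(\sum_(O in porbits T) f O)%R|%N.
  rewrite -sum1_card big_mkcond /= (bigID (mem (porbits T))) /=.
  rewrite [X in (_ + X)%N]big1 => [|O /negbTE]; last by rewrite inE => ->.
  rewrite addn0; apply/esym; elim/big_ind2: _ => [//|a m b l|O OT].
    by move=> ha hb; rewrite oddD -ha -hb odd_abszD.
  by rewrite (fE O OT).1 inE OT /=; case: (_ != _).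
have -> : \sum_(O in porbits T) f O = \sum_j x j + \sum_i y i.
  have [sum1 sum2] := sum_orbit_class.
  have MN0 : M%:Z * N%:Z != 0 by rewrite mulf_neq0; lia.
  apply: (mulIf MN0); rewrite mulr_suml (eq_bigr _ (fun O OT => (fE O OT).2)).
  rewrite big_split -!mulr_suml sum1 sum2.
  by rewrite mulrDl mulrAC [M%:Z * N%:Z * _]mulrC mulrAC [N%:Z * M%:Z * _]mulrC [N%:Z * M%:Z]mulrC.
have : (\sum_j x j = 0) \/ (\sum_i y i = 0) by move: k0; rewrite /kx /ky; lia.
by rewrite odd_abszD kxN kyM; case=> e; [move: kxN | move: kyM];
  rewrite e absz0 => <- /=; case: (odd _).
Qed.

End Classes.

(** * Parity of the number of cycles *)

Section Parity.

Local Open Scope ring_scope.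

Lemma sgn_transitive n (i j : 'Z_n) (e : int) : (e = 1) \/ (e = -1) ->
  exists m : nat, i + e%:~R *+ m = j.
Proof.
case=> ->; [exists (nat_of_ord (j - i))|exists (nat_of_ord (i - j))].
  by rewrite natr_Zp addrC subrK.
by rewrite mulrN1z mulNrn natr_Zp opprB addrC subrK.
Qed.

Lemma hperm_iter M N (x : 'Z_N -> int) m (v : 'Z_M * 'Z_N) :
  (hperm M x ^+ m)%g v = (v.1 + (x v.2)%:~R *+ m, v.2).
Proof.
elim: m => [|m IHm]; first by rewrite expg0 perm1 addr0; case: v.
by rewrite expgSr permM IHm permE /hstep /= mulrSr addrA.
Qed.

(** Each row is one cycle, since 1 and -1 both generate the cyclic group. *)
Lemma card_porbits_hperm M N (x : 'Z_N -> int) : (1 < N)%N -> sgn_fun x ->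
  #|porbits (hperm M x)| = N.
Proof.
move=> N1 sx; have cN : #|[set: 'Z_N]| = N by rewrite cardsT card_ord Zp_cast.
rewrite -[RHS]cN.
have -> : [set: 'Z_N] = snd @: [set: 'Z_M * 'Z_N].
  by apply/setP => j; rewrite inE; apply/esym/imsetP; exists (0, j).
rewrite -(card_imset_same_fibers (f := porbit (hperm M x))).
  by apply: eq_card => O; apply/imsetP/imsetP => -[u _ ->]; exists u.
move=> [i j] [i' j'] _ _; rewrite eq_porbit_mem; apply/porbitP/eqP => /= [[m]|->].
  by rewrite hperm_iter /= => -[_ ->].
by have [m <-] := sgn_transitive i' i (sx j'); exists m; rewrite hperm_iter.
Qed.

Lemma card_porbits_vperm M N (y : 'Z_M -> int) : (1 < M)%N -> sgn_fun y ->
  #|porbits (vperm N y)| = M.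
Proof.
move=> M1 sy; rewrite -[RHS](card_porbits_hperm N M1 sy).
apply: (card_porbits_conj (f := fun v => (v.2, v.1))).
  by exists (fun v => (v.2, v.1)) => -[].
by move=> [i j]; rewrite !permE.
Qed.

Lemma card_torus M N : (1 < M)%N -> (1 < N)%N -> #|{: 'Z_M * 'Z_N}| = (M * N)%N.
Proof. by move=> M1 N1; rewrite card_prod !card_ord !Zp_cast. Qed.

(** The sign of a permutation of M N points with c cycles is the parity of M N - c; multiplicativity
    gives that c has the parity of M N + M + N. *)
Lemma odd_porbits_turn M N (x : 'Z_N -> int) (y : 'Z_M -> int) :
  (1 < M)%N -> (1 < N)%N -> sgn_fun x -> sgn_fun y ->
  odd #|porbits (turn x y)| = odd M || odd N.
Proof.
move=> M1 N1 sx sy; have := odd_permM (hperm M x) (vperm N y).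
rewrite /odd_perm card_porbits_hperm // card_porbits_vperm // card_torus // oddM.
rewrite -/(turn x y).
by case: (odd M); case: (odd N); case: (odd #|_|).
Qed.

Lemma even_trivial_orbits M N (x : 'Z_N -> int) (y : 'Z_M -> int) :
  (1 < M)%N -> (1 < N)%N -> sgn_fun x -> sgn_fun y ->
  ~~ odd #|[set O in porbits (turn x y) | orbit_class x y O == (0, 0)]|.
Proof.
move=> M1 N1 sx sy; have := odd_porbits_turn M1 N1 sx sy.
rewrite -(odd_nontrivial_orbits M1 N1 sx sy).
rewrite -(cardsID [set O | orbit_class x y O == (0, 0)]) oddD.
have -> : porbits (turn x y) :\: [set O | orbit_class x y O == (0, 0)] =
    nontrivial_orbits x y by apply/setP => O; rewrite !inE andbC.
have -> : porbits (turn x y) :&: [set O | orbit_class x y O == (0, 0)] =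
    [set O in porbits (turn x y) | orbit_class x y O == (0, 0)].
  by apply/setP => O; rewrite !inE.
by case: (odd _); case: (odd _).
Qed.

End Parity.

Lemma sum_card_porbits (T : finType) (s : {perm T}) :
  \sum_(O in porbits s) #|O| = #|T|.
Proof.
rewrite -sum1_card; have := sum_porbits s (fun=> 1%N : nat).
rewrite (eq_bigr (fun O : {set T} => #|O|)) => [->|O _]; last exact: sum1_card.
exact: eq_bigl.
Qed.

(** * Symmetric patterns *)

Section SquareOrbits.

Local Open Scope ring_scope.

Lemma sum_inv_card_porbit (T : finType) (s : {perm T}) :
  \sum_v (#|porbit s v|%:R)^-1 = #|porbits s|%:R :> rat.
Proof.
rewrite -(sum_porbits s) -sum1_card natr_sum; apply: eq_bigr => _ /imsetP[v _ ->].
rewrite (eq_bigr (fun=> (#|porbit s v|%:R)^-1)) => [|u]; last first.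
  by rewrite -eq_porbit_mem => /eqP->.
by rewrite sumr_const -[LHS]mulr_natr mulVf // pnatr_eq0 card_porbit_neq0.
Qed.

Variables (T : finType) (s : {perm T}).

Lemma card_porbit_square v :
  #|porbit (s ^+ 2)%g v| = if odd #|porbit s v| then #|porbit s v| else #|porbit s v|./2.
Proof.
set n := #|porbit s v|; set m := #|porbit _ v|.
have mE i : (m %| i)%N = (n %| 2 * i)%N by rewrite -!porbit_fixed_dvdn -expgM.
have [n_odd|n_even] := boolP (odd n); apply/eqP; rewrite eqn_dvd mE.
  rewrite dvdn_mull //= -(@Gauss_dvdr n 2 m) ?coprimen2 //.
  by rewrite -mE.
rewrite mul2n halfK (negbTE n_even) subn0 dvdnn /=.
rewrite -(@dvdn_pmul2l 2) // mul2n halfK (negbTE n_even) subn0.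
by rewrite -mE.
Qed.

(** Every point is weighted by the inverse length of its cycle. Squaring keeps the length of an odd
    cycle and halves that of an even one. *)
Lemma card_porbits_square :
  (#|porbits (s ^+ 2)%g| + #|[set O in porbits s | odd #|O|]| = 2 * #|porbits s|)%N.
Proof.
have: (#|porbits (s ^+ 2)%g|%:R + #|[set O in porbits s | odd #|O| ]|%:R =
       2 * #|porbits s|%:R :> rat); last first.
  by rewrite -natrM -natrD => /eqP; rewrite eqr_nat => /eqP.
have -> : #|[set O in porbits s | odd #|O| ]|%:R =
    \sum_v (odd #|porbit s v|)%:R * (#|porbit s v|%:R)^-1 :> rat.
  rewrite -(sum_porbits s) -sum1_card natr_sum big_mkcond [in RHS]big_mkcond /=.
  apply: eq_bigr => O _; rewrite inE; case: imsetP => [[v _ ->]|//] /=.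
  rewrite (eq_bigr (fun=> (odd #|porbit s v|)%:R * (#|porbit s v|%:R)^-1)) => [|u]; last first.
    by rewrite -eq_porbit_mem => /eqP->.
  rewrite sumr_const -[RHS]mulr_natr -mulrA mulVf ?pnatr_eq0 ?card_porbit_neq0 // mulr1.
  by case: (odd _).
rewrite -!sum_inv_card_porbit mulr_sumr -big_split; apply: eq_bigr => v _ /=.
rewrite card_porbit_square; have := card_porbit_neq0 s v.
set n := #|porbit s v| => n0.
have [n_odd|n_even] := boolP (odd n); first by rewrite mul1r -mulr2n mulr_natl.
have nE : n = (n./2 * 2)%N by rewrite muln2 halfK (negbTE n_even) subn0.
by rewrite mul0r addr0 [in RHS]nE natrM invfM mulrCA divff ?mulr1.
Qed.

End SquareOrbits.

Section Symmetric.

Local Open Scope ring_scope.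

Variables (N : nat) (x : 'Z_N -> int).

(** A horizontal step followed by the exchange of the coordinates. *)
Definition half_turn_fun (v : 'Z_N * 'Z_N) := (v.2, v.1 + (x v.2)%:~R).

Lemma half_turn_funK : cancel half_turn_fun (fun v => (v.2 - (x v.1)%:~R, v.1)).
Proof. by case=> i j; rewrite /half_turn_fun /= addrK. Qed.

Definition half_turn : {perm 'Z_N * 'Z_N} := perm (can_inj half_turn_funK).

Lemma half_turn_square : (half_turn ^+ 2)%g = turn x x.
Proof. by apply/permP => -[i j]; rewrite turnE expgS expg1 permM !permE. Qed.

Definition half_turnZ (w : Z * Z) : Z * Z := (w.2, (w.1 + lift x w.2)%zz).

Lemma iter_turnZ_half n w : iter n (turnZ x x) w = iter n.*2 half_turnZ w.
Proof. by elim: n => //= n ->. Qed.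

Lemma red2_half_turnZ n w :
  red2 N N (iter n half_turnZ w) = iter n half_turn (red2 N N w).
Proof.
elim: n => //= n <-; rewrite permE /half_turn_fun /red2 /half_turnZ /=.
by rewrite redD /lift red_int.
Qed.

Hypotheses (N1 : (1 < N)%N) (sx : sgn_fun x).

Let k := Z_of_int (\sum_i x i).
Let c w := level (height x) (height x) (turn_path x x w O).

Lemma half_turnZ_translate n e f w : iter n half_turnZ (translate N N e f w) =
  if odd n then translate N N f e (iter n half_turnZ w)
  else translate N N e f (iter n half_turnZ w).
Proof.
elim: n => //= n ->; have half e' f' u :
    half_turnZ (translate N N e' f' u) = translate N N f' e' (half_turnZ u).
  by rewrite /half_turnZ /translate /= /lift redD red_period // addr0; congr pair; lia.
by case: (odd n) => /=; rewrite half.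
Qed.

(* Exchanging the two coordinates changes the sign of the level. *)
Lemma level_half_turnZ n w : c (iter n half_turnZ w) = if odd n then (- c w)%zz else c w.
Proof.
elim: n => // n IHn; rewrite iterS oddS; move: IHn; move: (iter n _ _) => u.
have -> : c (half_turnZ u) = (- c u)%zz.
  (* The second midpoint of the path from u is, with its coordinates exchanged, the first midpoint
     of the path from [half_turnZ u]. *)
  rewrite /c -(contour_level (turn_path_contour N1 N1 sx sx u) 1).
  rewrite /level /turn_path /= /half_turnZ /=.
  move: (lift x u.2) => a; move: (lift x (u.1 + a)%zz) => b.
  rewrite (_ : u.2 + (u.2 + b) = 2 * u.2 + b)%zz; last lia.
  lia.
by case: (odd n) => /= ->; lia.
Qed.

Lemma level_translate e f w : c (translate N N e f w) = (c w + 2 * k * (f - e))%zz.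
Proof.
have translE a t : height x (t + a * (2 * Z.of_nat N))%zz = (height x t + a * (2 * k))%zz.
  by apply: drift_iter; apply: height_drift.
rewrite /c /level /turn_path /turnZ /translate /= /lift redD red_period // addr0 -/(lift x w.2).
rewrite (_ : 2 * (w.2 + f * Z.of_nat N) = 2 * w.2 + f * (2 * Z.of_nat N))%zz; last lia.
rewrite (_ : w.1 + e * Z.of_nat N + (w.1 + e * Z.of_nat N + lift x w.2) =
  w.1 + (w.1 + lift x w.2) + e * (2 * Z.of_nat N))%zz; last lia.
by rewrite !translE; lia.
Qed.

Lemma turnZ_parity n w : exists j,
  ((iter n (turnZ x x) w).1 = w.1 + Z.of_nat n + 2 * j)%zz.
Proof.
elim: n => [|n [j IHn]]; first by exists 0%zz; rewrite /=; lia.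
rewrite iterS /turnZ /= -/(turnZ x x) IHn; move: (iter n _ _).2 => t.
by have := sx (red N t); rewrite /lift; case=> ->; [exists j | exists (j - 1)%zz]; lia.
Qed.

(** If n half turns translate the lift by (e, f), then n turns translate it by (e + f, e + f). Each
    turn flips the parity of the first coordinate, so (e + f) N is odd; hence N is odd, k is nonzero
    and the direction of the class is known. *)
Lemma odd_half_turn_orbit v : odd #|porbit half_turn v| ->
  odd N /\ exists w, [/\ red2 N N w = v, c w = (- Z.abs k)%zz &
    iter #|porbit half_turn v| (turnZ x x) w = translate N N (Z.sgn k) (Z.sgn k) w].
Proof.
set n := #|_| => n_odd.
pose w : Z * Z := (Z.of_nat v.1, Z.of_nat v.2).
have vE : red2 N N w = v by rewrite /red2 /= !red_surj; case: (v).
have [e [f ef]] : exists e f, iter n half_turnZ w = translate N N e f w.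
  by apply: red2_eq => //; rewrite red2_half_turnZ vE iter_porbit.
have turn_n : iter n (turnZ x x) w = translate N N (e + f)%zz (e + f)%zz w.
  rewrite iter_turnZ_half -addnn iterD ef half_turnZ_translate n_odd ef.
  by rewrite /translate /=; congr pair; lia.
have [j] := turnZ_parity n w; rewrite turn_n /translate /= => parity.
have [l nE] : exists l, Z.of_nat n = (2 * l + 1)%zz.
  by exists (Z.of_nat n./2); move: n_odd; clear; lia.
have {}parity : ((e + f) * Z.of_nat N = 2 * (l + j) + 1)%zz by move: parity nE; clear; lia.
have oddN : odd N.
  apply/negPn/negP => N_even; have [h NE] : exists h, Z.of_nat N = (2 * h)%zz.
    by exists (Z.of_nat N./2); move: N_even; clear; lia.
  by move: parity; rewrite NE; clear; lia.
have ef0 : (e + f <> 0)%zz by move=> e0; move: parity; rewrite e0; clear; lia.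
have k0 : k <> 0%zz.
  by move=> k0; have := sum_sgn_parity N1 sx; rewrite oddN; move: k0; rewrite /k; lia.
have efE : (e + f)%zz = Z.sgn k.
  have card_n : #|porbit (turn x x) v| = n.
    by rewrite -half_turn_square card_porbit_square n_odd.
  have := @orbit_direction _ _ _ _ N1 N1 sx sx w (e + f)%zz (e + f)%zz
    (Z.abs k) (Z.sgn k) (Z.sgn k).
  cbv zeta; rewrite vE card_n -/k => -[] //; try lia.
    by move=> [h _]; case: ef0.
  by have [->|->] : Z.sgn k = 1%zz \/ Z.sgn k = (-1)%zz by lia.
(* An odd number of half turns negates the level, so the level of w is k (e - f); translating by (e,
   0) normalizes it to - k (e + f), which is - |k|. *)
split=> //; exists (translate N N e 0%zz w); split.
- by rewrite red2_translate.
- have := level_half_turnZ n w; rewrite ef n_odd !level_translate; lia.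
by rewrite iter_turnZ_translate // turn_n efE /translate /=; congr pair; lia.
Qed.

(** The lengths add up to N N, which gives the parity of the number of odd cycles. There is at most
    one, because two of them would have lifts on the same level with nonzero class, and such curves
    meet. *)
Lemma card_odd_half_turn_orbits :
  #|[set O in porbits half_turn | odd #|O| ]| = odd N.
Proof.
have parity : odd #|[set O in porbits half_turn | odd #|O| ]| = odd N.
  rewrite -[odd N]andbb -oddM -(card_torus N1 N1) -(sum_card_porbits half_turn).
  rewrite -sum1_card big_mkcond /=.
  rewrite (bigID (mem (porbits half_turn))) /= [X in (_ + X)%N]big1 => [|O /negbTE]; last first.
    by rewrite inE => ->.
  rewrite addn0; elim/big_ind2: _ => [//|a m b l ha hb|O OT]; first by rewrite !oddD ha hb.
  by rewrite inE OT /=; case: (odd #|O|).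
have le1 : (#|[set O in porbits half_turn | odd #|O| ]| <= 1)%N.
  apply/card_le1P => O; rewrite inE => /andP[/imsetP[v _ ->] odd_v] O'.
  rewrite !inE; apply/andP/eqP => [[/imsetP[v' _ ->] odd_v']|->]; last by rewrite imset_f.
  have [oddN [w [vE cw pw]]] := odd_half_turn_orbit odd_v.
  have [_ [w' [vE' cw' pw']]] := odd_half_turn_orbit odd_v'.
  have k0 : k <> 0%zz.
    by move=> k0; have := sum_sgn_parity N1 sx; rewrite oddN; move: k0; rewrite /k; lia.
  have pp := turn_path_periodic N1 N1 sx sx pw.
  have pp' := turn_path_periodic N1 N1 sx sx pw'.
  have meet := @contour_meeting (2 * Z.of_nat N)%zz (2 * Z.of_nat N)%zz (2 * k)%zz (2 * k)%zz.
  have sg0 : (Z.sgn k, Z.sgn k) <> (0%zz, 0%zz) by case; lia.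
  have [|||||||_ [r [r' rr']]] := meet _ _ _ _ _ _ (walk_height sx) (walk_height sx)
    (height_drift x N1) (height_drift x N1) _ _ _ _ _ _
    (0 * (2 * Z.of_nat N))%zz (0 * (2 * Z.of_nat N))%zz 0%zz pp sg0 pp' sg0.
  - lia.
  - lia.
  - lia.
  - lia.
  - by rewrite -/(c w) -/(c w') cw cw'.
  - by move=> t; rewrite Z.mul_0_l !Z.add_0_r.
  - by move=> t; rewrite Z.mul_0_l !Z.add_0_r.
  have [m [m' mm']] := turn_path_shift_inv N1 N1 sx sx rr'.
  have := congr1 (red2 N N) mm'; rewrite red2_translate // !red2_iter vE vE'.
  rewrite -!permX -half_turn_square -!expgM => e.
  by apply/eqP; rewrite -(porbit_perm half_turn (2 * m')) e porbit_perm.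
move: parity le1; case: #|_| => [|[|n]] //= <- //.
Qed.

End Symmetric.

(** * The congruence modulo 4 *)

Section ModFour.

Local Open Scope ring_scope.

(** The half turn is [hperm] times a fixed involution, and [hperm] has N cycles whatever the signs
    are. *)
Lemma odd_porbits_half_turn N (x x' : 'Z_N -> int) : (1 < N)%N ->
  sgn_fun x -> sgn_fun x' ->
  odd #|porbits (half_turn x)| = odd #|porbits (half_turn x')|.
Proof.
move=> N1 sx sx'; pose swap (v : 'Z_N * 'Z_N) := (v.2, v.1).
have swapK : cancel swap swap by case.
have half_turnE z : half_turn z = (hperm N z * perm (can_inj swapK))%g.
  by apply/permP => -[i j]; rewrite permM !permE.
have := odd_permM (hperm N x) (perm (can_inj swapK)).
have := odd_permM (hperm N x') (perm (can_inj swapK)).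
rewrite -!half_turnE /odd_perm !card_porbits_hperm //.
by move=> <- /addbI.
Qed.

(** The cycles are the diagonals, told apart by the difference of the coordinates. *)
Lemma card_porbits_constant N (x : 'Z_N -> int) : (1 < N)%N -> sgn_fun x ->
  (forall i, x i = x 0) -> #|porbits (turn x x)| = N.
Proof.
move=> N1 sx x_const; have cN : #|[set: 'Z_N]| = N by rewrite cardsT card_ord Zp_cast.
have iterE m (v : 'Z_N * 'Z_N) :
    (turn x x ^+ m)%g v = (v.1 + (x 0)%:~R *+ m, v.2 + (x 0)%:~R *+ m).
  elim: m => [|m IHm]; first by rewrite expg0 perm1 !addr0; case: v.
  by rewrite expgSr permM IHm turnE /vstep /hstep /= !(x_const (_ + _)) !mulrSr !addrA.
rewrite -[RHS]cN; have -> : [set: 'Z_N] = (fun v => v.1 - v.2) @: [set: 'Z_N * 'Z_N].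
  by apply/setP => j; rewrite inE; apply/esym/imsetP; exists (j, 0); rewrite ?subr0.
rewrite -(card_imset_same_fibers (f := porbit (turn x x))).
  by apply: eq_card => O; apply/imsetP/imsetP => -[u _ ->]; exists u.
move=> [i j] [i' j'] _ _; rewrite eq_porbit_mem /=; apply/porbitP/eqP => [[m]|e].
  by rewrite iterE /= => -[-> ->]; rewrite opprD addrACA subrr addr0.
have [m mE] := sgn_transitive i' i (sx 0); exists m.
rewrite iterE /= mE; congr pair.
have -> : j = i - (i' - j') by rewrite -e opprB addrCA subrr addr0.
by rewrite -mE opprB [LHS]addrC addrA subrK.
Qed.

Lemma card_porbits_mod4 N (x : 'Z_N -> int) : (1 < N)%N -> sgn_fun x ->
  #|porbits (turn x x)| = N %[mod 4].
Proof.
move=> N1 sx; pose one (i : 'Z_N) : int := 1.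
have s1 : sgn_fun one by left.
have := card_porbits_constant N1 s1 (fun=> erefl).
have := card_porbits_square (half_turn x); have := card_porbits_square (half_turn one).
rewrite !card_odd_half_turn_orbits // !half_turn_square.
have := odd_porbits_half_turn N1 sx s1.
move: #|_| #|_| #|_| #|_| => a b c d; lia.
Qed.

End ModFour.

(** * Inserting two rows *)

Section Transpositions.

Local Open Scope nat_scope.

(** A transposition changes the number of cycles by at most one. *)
Lemma card_porbits_prod_tperm (T I : finType) (f g : I -> T) (r : seq I) (s : {perm T}) :
  #|porbits s| <= #|porbits ((\prod_(i <- r) tperm (f i) (g i)) * s)%g| + size r.
Proof.
elim: r => [|i r IHr]; first by rewrite big_nil mul1g addn0.
rewrite big_cons -mulgA; have := porbits_mul_tperm
  ((\prod_(j <- r) tperm (f j) (g j)) * s)%g (f i) (g i).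
case: (boolP (f i \in _)) => [_|nin] /= e; apply: leq_trans IHr _.
  by rewrite addn0 in e; rewrite e -addnA leq_add2l; lia.
have ne : f i != g i by apply: contraNneq nin => ->; apply: porbit_id.
by rewrite ne in e; rewrite -addSnnS leq_add2r -(leq_add2r true) -e addSn -addnS.
Qed.

Lemma prod_tperm_out (T I : finType) (f g : I -> T) (r : seq I) u :
  (forall i, i \in r -> u != f i) -> (forall i, i \in r -> u != g i) ->
  (\prod_(i <- r) tperm (f i) (g i))%g u = u.
Proof.
elim: r => [|i r IHr] uf ug; first by rewrite big_nil perm1.
rewrite big_cons permM tpermD 1?eq_sym ?uf ?ug ?mem_head //.
by apply: IHr => j jr; [apply: uf | apply: ug]; rewrite inE jr orbT.
Qed.

Lemma prod_tperm_swap (T I : finType) (f g : I -> T) (r : seq I) i :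
  injective f -> injective g -> (forall i j, f i != g j) -> uniq r -> i \in r ->
  let s := (\prod_(i <- r) tperm (f i) (g i))%g in s (f i) = g i /\ s (g i) = f i.
Proof.
move=> fI gI fg; elim: r => [|j r IHr] //= /andP[jr Ur].
rewrite inE big_cons !permM; have [->|ij] /= := eqVneq i j => [_|ir].
  rewrite tpermL tpermR !prod_tperm_out //.
  - by move=> l lr; rewrite (inj_eq fI); apply: contraNneq jr => ->.
  - by move=> l lr; rewrite eq_sym fg.
  - by move=> l lr; rewrite (inj_eq gI); apply: contraNneq jr => ->.
have -> : tperm (f j) (g j) (f i) = f i.
  by apply: tpermD; [rewrite (inj_eq fI) eq_sym | rewrite eq_sym].
have -> : tperm (f j) (g j) (g i) = g i.
  by apply: tpermD; [ | rewrite (inj_eq gI) eq_sym].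
exact: IHr.
Qed.

End Transpositions.

Section Insertion.

Local Open Scope ring_scope.

Variables (M n : nat) (x : 'Z_n.+2 -> int) (x' : 'Z_n -> int) (y : 'Z_M -> int).
Hypotheses (M1 : (1 < M)%N) (n1 : (1 < n)%N) (sy : sgn_fun y).

(** The inserted rows are the last two, -2 and -1, between the old rows n - 1 and 0. *)
Definition widenZ (j : 'Z_n) : 'Z_n.+2 := (nat_of_ord j)%:R.

Hypotheses (x_old : forall j, x (widenZ j) = x' j) (x_up : x (- 2%:R) = 1) (x_down : x (-1) = -1).

Lemma ltn_Zp (j : 'Z_n) : (j < n)%N.
Proof. by rewrite -[X in (_ < X)%N](Zp_cast n1). Qed.

Lemma Zp_oppr1 : (-1 : 'Z_n) = n.-1%:R.
Proof.
by apply: (addIr 1); rewrite addNr natr1 prednK ?pchar_Zp //; lia.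
Qed.

Lemma widenZ_oppr1 : widenZ (-1) = n.-1%:R.
Proof. by rewrite /widenZ Zp_oppr1 val_Zp_nat // modn_small //; lia. Qed.

Lemma widen_size : n%:R = - 2%:R :> 'Z_n.+2.
Proof. by apply: (addIr 2%:R); rewrite addNr -natrD addn2 pchar_Zp. Qed.

Lemma widenZ_up j : widenZ j + 1 = if j == -1 then - 2%:R else widenZ (j + 1).
Proof.
case: eqP => [->|jN1].
  by rewrite widenZ_oppr1 natr1 prednK ?widen_size //; lia.
rewrite /widenZ -[j + 1](_ : (j.+1)%:R = _); last by rewrite -natr1 natr_Zp.
rewrite val_Zp_nat // modn_small ?natr1 //.
have := ltn_Zp j; rewrite leq_eqVlt => /orP[/eqP jn|//].
by case: jN1; rewrite Zp_oppr1 -(congr1 predn jn) /= natr_Zp.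
Qed.

Lemma widenZ_down j : widenZ j - 1 = if j == 0 then -1 else widenZ (j - 1).
Proof.
case: eqP => [->|j0]; first by rewrite /widenZ sub0r.
have := widenZ_up (j - 1); rewrite subrK; case: eqP => [e|_ <-]; last by rewrite addrK.
by case: j0; apply: (addIr (-1)); rewrite e add0r.
Qed.

Lemma widenZ_new j : widenZ j != - 2%:R /\ widenZ j != -1.
Proof.
have jn := ltn_Zp j; rewrite -widen_size.
have -> : -1 = n.+1%:R :> 'Z_n.+2 by rewrite -natr1 widen_size mulr2n opprD addrNK.
split; apply/eqP => /(congr1 (@nat_of_ord _)); rewrite /widenZ !val_Zp_nat // !modn_small //; lia.
Qed.

Lemma widenZ_inj : injective widenZ.
Proof.
move=> i j /(congr1 (@nat_of_ord _)); rewrite /widenZ !val_Zp_nat // !modn_small.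
- exact: val_inj.
- by have := ltn_Zp j; lia.
- by have := ltn_Zp i; lia.
Qed.

Let iota (v : 'Z_M * 'Z_n) : 'Z_M * 'Z_n.+2 := (v.1, widenZ v.2).
Let T := turn x y.
Let T' := turn x' y.
Let peaks := [seq i <- enum 'Z_M | (y i == 1) && (y (i + 1) == -1)].
(** If Y has a local maximum between columns i and i + 1, a path entering the new rows upwards in
    column i comes back down in column i + 1 instead of reaching row 0, and one entering downwards
    in column i + 1 comes back up in column i. *)
Let tau := (\prod_(i <- peaks) tperm (i, 0 : 'Z_n) (i + 1, -1))%g.

Lemma mem_peak i : (i \in peaks) = (y i == 1) && (y (i + 1) == -1).
Proof. by rewrite mem_filter mem_enum andbT. Qed.

Lemma Zp_oppr1_neq0 : (-1 : 'Z_n) != 0.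
Proof. by rewrite oppr_eq0 oner_eq0. Qed.

Lemma tau_peak i : y i = 1 -> y (i + 1) = -1 ->
  tau (i, 0) = (i + 1, -1) /\ tau (i + 1, -1) = (i, 0).
Proof.
move=> yi yi1; apply: (@prod_tperm_swap _ _ (fun i => (i, 0)) (fun i => (i + 1, -1))).
- by move=> a b [].
- by move=> a b /(congr1 fst) /= /addIr.
- by move=> a b; rewrite xpair_eqE [0 == _]eq_sym (negbTE Zp_oppr1_neq0) andbF.
- exact: filter_uniq (enum_uniq _).
- by rewrite mem_peak yi yi1.
Qed.

Lemma tau_id i j : ~ (j = 0 /\ y i = 1 /\ y (i + 1) = -1) ->
  ~ (j = -1 /\ y (i - 1) = 1 /\ y i = -1) -> tau (i, j) = (i, j).
Proof.
move=> not0 notN1; apply: prod_tperm_out => l; rewrite mem_peak => /andP[/eqP yl /eqP yl1].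
  by apply/eqP => -[e1 e2]; apply: not0; rewrite e1 e2.
by apply/eqP => -[e1 e2]; apply: notN1; rewrite e1 e2 addrK.
Qed.

Lemma turn_newE i : T (i, - 2%:R) = (i + 1, - 2%:R + (y (i + 1))%:~R) /\
  T (i, -1) = (i - 1, - 1 + (y (i - 1))%:~R).
Proof. by rewrite /T !turnE /vstep /hstep /= x_up x_down. Qed.

(** The return takes one step if the new rows are not entered, two if a local maximum of Y sends the
    path back, and three if it crosses both rows, in which case it leaves them in the column in
    which it entered. *)
Lemma first_return v : exists m,
  (T ^+ m.+1)%g (iota v) = iota (tau (T' v)) /\
  forall m', (0 < m' <= m)%N -> forall w, (T ^+ m')%g (iota v) <> iota w.
Proof.
have step1 m u : (T ^+ m.+1)%g u = (T ^+ m)%g (T u) by rewrite expgS permM.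
have new i b w : (b = - 2%:R \/ b = -1) -> (i, b) <> iota w.
  by have [/eqP n2 /eqP n1'] := widenZ_new w.2; case=> -> [_ e]; [apply: n2 | apply: n1'].
case: v => i0 j0; have T'E : T' (i0, j0) = (i0 + (x' j0)%:~R,
    j0 + (y (i0 + (x' j0)%:~R))%:~R) by rewrite /T' turnE.
have TE : T (iota (i0, j0)) = (i0 + (x' j0)%:~R,
    widenZ j0 + (y (i0 + (x' j0)%:~R))%:~R).
  by rewrite /T turnE /vstep /hstep /= x_old.
rewrite T'E; move: TE; move: (i0 + _) => i TE.
have up2 : - 2%:R + 1 = -1 :> 'Z_n.+2 by rewrite mulr2n opprD addrNK.
have down1 : -1 - 1 = - 2%:R :> 'Z_n.+2 by rewrite -opprD.
have up1 : -1 + 1 = widenZ 0 by rewrite addNr.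
have down2 : - 2%:R - 1 = widenZ (-1).
  by have := widenZ_up (-1); rewrite eqxx => <-; rewrite addrK.
case: (sy i) => yi; rewrite yi /= ?mulr1z ?mulrN1z in TE *.
  have := widenZ_up j0; case: eqP => [j0E|jN1] upE; rewrite upE in TE; last first.
    exists 0%N; split=> [|m' hm]; last by lia.
    rewrite expg1 TE tau_id //.
    + by case=> e _; apply: jN1; apply: (addIr 1); rewrite e addNr.
    + by case=> _ [_]; rewrite yi.
  rewrite j0E addNr; rewrite j0E in TE; case: (sy (i + 1)) => yi1.
    exists 2%N; rewrite !step1 TE (turn_newE i).1 yi1 up2 (turn_newE _).2 addrK yi up1 expg0 perm1.
    split; first by rewrite tau_id // => -[];
      [rewrite yi1 => _ [] | move/esym/eqP; rewrite (negbTE Zp_oppr1_neq0)].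
    case=> [|[|[|m']]] // _ w; rewrite !step1 expg0 perm1 TE; first by apply: new; left.
    by rewrite (turn_newE i).1 yi1 up2; apply: new; right.
  exists 1%N; rewrite !step1 TE (turn_newE i).1 yi1 mulrN1z down2 expg0 perm1.
  split; first by rewrite (tau_peak yi yi1).1.
  by case=> [|[|m']] // _ w; rewrite !step1 expg0 perm1 TE; apply: new; left.
have := widenZ_down j0; case: eqP => [j0E|j0n] downE; rewrite downE in TE; last first.
  exists 0%N; split=> [|m' hm]; last by lia.
  rewrite expg1 TE tau_id //.
  + by case=> _ []; rewrite yi.
  + by case=> e _; apply: j0n; apply: (addIr (-1)); rewrite e add0r.
rewrite j0E add0r; rewrite j0E in TE; case: (sy (i - 1)) => yi1.
  exists 1%N; rewrite !step1 TE (turn_newE i).2 yi1 mulr1z up1 expg0 perm1.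
  split; first by have [] := @tau_peak (i - 1) yi1; rewrite subrK // => _ ->.
  by case=> [|[|m']] // _ w; rewrite !step1 expg0 perm1 TE; apply: new; right.
exists 2%N; rewrite !step1 TE (turn_newE i).2 yi1 mulrN1z down1 (turn_newE _).1 subrK yi.
rewrite mulrN1z down2 expg0 perm1.
split; first by rewrite tau_id // => -[];
  [move/eqP; rewrite (negbTE Zp_oppr1_neq0) | rewrite yi1 => _ []].
case=> [|[|[|m']]] // _ w; rewrite !step1 expg0 perm1 TE; first by apply: new; right.
by rewrite (turn_newE i).2 yi1 mulrN1z down1; apply: new; left.
Qed.

(** A path of T between old points splits into first returns. Thus distinct cycles of the
    first-return map lie in distinct cycles of T. *)
Lemma porbit_first_return v w :
  iota w \in porbit T (iota v) -> w \in porbit (T' * tau)%g v.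
Proof.
case/porbitP => m; elim/ltn_ind: m v => m IHm v.
have iota_inj : injective iota by move=> [a b] [c d] [-> /widenZ_inj->].
have [k [kE knew]] := first_return v.
case: m IHm => [|m] IHm; first by rewrite expg0 perm1 => /iota_inj ->; apply: porbit_id.
have [lt|le] := ltnP m k; first by move/esym/knew => [].
rewrite -(subnKC (m := k.+1) (n := m.+1)) // expgD permM kE => e.
rewrite -(porbit_perm _ 1) expg1 permM; apply: IHm e; lia.
Qed.

(** A local minimum of Y closes up a 2-cycle inside the new rows. *)
Lemma valley_orbit i u : y i = -1 -> y (i + 1) = 1 ->
  u \in porbit T (i, - 2%:R) -> u = (i, - 2%:R) \/ u = (i + 1, -1).
Proof.
move=> yi yi1 /porbitP[m ->]; elim: m => [|m IHm]; first by rewrite expg0 perm1; left.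
rewrite expgSr permM; case: IHm => ->; [right | left].
  by rewrite (turn_newE i).1 yi1 mulr1z mulr2n opprD addrNK.
by rewrite (turn_newE _).2 addrK yi mulrN1z -opprD.
Qed.

(** P and its shift Q have the same size, hence so do the two differences. *)
Lemma card_valleys : #|[set i : 'Z_M | (y i == -1) && (y (i + 1) == 1)]| = size peaks.
Proof.
have -> : size peaks = #|[set i | (y i == 1) && (y (i + 1) == -1)]|.
  have /card_uniqP <- : uniq peaks by apply: filter_uniq; apply: enum_uniq.
  by apply: eq_card => i; rewrite [RHS]inE mem_peak.
have sN i : (y i == -1) = ~~ (y i == 1) by case: (sy i) => ->.
pose P := [set i | y i == 1]; pose Q := [set i | y (i + 1) == 1].
have cPQ : #|P| = #|Q|.
  have -> : P = (fun i => i + 1) @: Q; last by rewrite card_imset //; apply: addIr.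
  apply/setP => i; rewrite inE; apply/idP/imsetP => [yi|[l]]; last by rewrite inE => ? ->.
  by exists (i - 1); rewrite ?inE subrK.
have -> : [set i | (y i == -1) && (y (i + 1) == 1)] = Q :\: P.
  by apply/setP => i; rewrite !inE sN.
have -> : [set i | (y i == 1) && (y (i + 1) == -1)] = P :\: Q.
  by apply/setP => i; rewrite !inE sN andbC.
by move: cPQ; rewrite -(cardsID Q P) -(cardsID P Q) [Q :&: P]setIC => /addnI.
Qed.

(** The transpositions cost at most one cycle per peak, which the 2-cycles at the equally many
    valleys make up for. *)
Lemma card_porbits_insert : (#|porbits T'| <= #|porbits T|)%N.
Proof.
pose valleys := [set i | (y i == -1) && (y (i + 1) == 1)].
pose old := (fun v => porbit T (iota v)) @: [set: 'Z_M * 'Z_n].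
pose new := (fun i => porbit T (i, - 2%:R)) @: valleys.
have newE i : i \in valleys -> y i = -1 /\ y (i + 1) = 1.
  by rewrite inE => /andP[/eqP ? /eqP ?].
have twoN1 : - 2%:R != -1 :> 'Z_n.+2.
  by rewrite eqr_opp -subr_eq0 mulr2n addrK oner_eq0.
have c_new : #|new| = size peaks.
  rewrite -card_valleys card_in_imset // => i l /newE[yi yi1] _ e.
  have := porbit_id T (l, - 2%:R); rewrite -e => /(valley_orbit yi yi1).
  case=> [/(congr1 fst) /= -> //|/(congr1 snd) /= /eqP].
  by rewrite (negbTE twoN1).
have c_old : (#|porbits (T' * tau)%g| <= #|old|)%N.
  have -> : #|porbits (T' * tau)%g| = #|porbit (T' * tau)%g @: [set: 'Z_M * 'Z_n]|.
    by apply: eq_card => O; apply/imsetP/imsetP => -[u _ ->]; exists u.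
  apply: leq_card_imset => v w _ _ /eqP; rewrite eq_porbit_mem => /porbit_first_return.
  by rewrite -eq_porbit_mem => /eqP.
have disj : [disjoint old & new].
  rewrite -setI_eq0; apply/eqP/setP => O; rewrite !inE; apply/negbTE/negP.
  case/andP=> /imsetP[v _ ->] /imsetP[i /newE[yi yi1] e].
  have := porbit_id T (iota v); rewrite e => /(valley_orbit yi yi1).
  by have [/eqP h1 /eqP h2] := widenZ_new v.2; case=> /(congr1 snd) /=; [apply: h1 | apply: h2].
have sub : old :|: new \subset porbits T.
  by apply/subsetP => O; rewrite inE => /orP[] /imsetP[u _ ->]; apply: imset_f.
have := subset_leq_card sub; rewrite cardsU disjoint_setI0 // cards0 subn0 c_new.
have := @card_porbits_prod_tperm _ _ (fun i => (i, 0 : 'Z_n)) (fun i => (i + 1, -1)) peaks T'.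
(* The bound has the transpositions on the left, the first return on the right; the two products are
   conjugate. *)
rewrite -/tau (card_porbits_conj (s := (tau * T')%g) (t := (T' * tau)%g) (f := tau)); last 2 first.
- by exists (tau^-1)%g; [apply: permK | apply: permKV].
- by move=> v; rewrite (permM tau T') (permM T' tau).
move=> le1 le2; apply: leq_trans le1 _; apply: leq_trans le2.
by rewrite leq_add2r.
Qed.

End Insertion.

(** * The lower bound for symmetric patterns *)

Section LowerBound.

Local Open Scope ring_scope.

(** The two orders of composing the row and column steps are conjugate by the row step; exchanging
    coordinates then swaps the roles of x and y. *)
Lemma card_porbits_transpose M N (x : 'Z_N -> int) (y : 'Z_M -> int) :
  #|porbits (turn x y)| = #|porbits (turn y x)|.
Proof.
apply: (card_porbits_conj (f := fun v => ((hstep x v).2, (hstep x v).1))).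
  exists (fun u => (u.2 - (x u.1)%:~R, u.1)) => [] [i j] /=; first by rewrite addrK.
  by rewrite /hstep /= subrK.
by move=> v; rewrite !turnE.
Qed.

Lemma card_porbits_rotate M N (x z : 'Z_N -> int) (y : 'Z_M -> int) r :
  (forall j, z j = x (j + r)) -> #|porbits (turn z y)| = #|porbits (turn x y)|.
Proof.
move=> zE; apply: (card_porbits_conj (f := fun v => (v.1, v.2 + r))).
  by exists (fun v => (v.1, v.2 - r)) => -[i j] /=; rewrite ?addrK ?subrK.
by move=> [i j]; rewrite !turnE /vstep /hstep /= zE addrAC.
Qed.

Lemma sgn_ascent N (x : 'Z_N -> int) : sgn_fun x -> ~ (forall i, x i = x 0) ->
  exists i, x i = 1 /\ x (i + 1) = -1.
Proof.
move=> sx x_var; case: (pickP [pred i | (x i == 1) && (x (i + 1) == -1)]) => [i|none].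
  by case/andP=> /eqP ? /eqP ?; exists i.
have step i : x i = 1 -> x (i + 1) = 1.
  by move=> xi; have /= := none i; rewrite xi eqxx /=; case: (sx (i + 1)) => ->.
have steps i (m : nat) : x i = 1 -> x (i + m%:R) = 1.
  by move=> xi; elim: m => [|m IHm]; rewrite ?addr0 // -natr1 addrA; apply: step.
have all1 i j : x i = 1 -> x j = 1.
  by move=> /(steps i (nat_of_ord (j - i))); rewrite natr_Zp addrC subrK.
case: x_var => i; case: (sx i) => xi; first by rewrite xi (all1 i 0 xi).
by case: (sx 0) => x0; [rewrite (all1 0 i x0) | rewrite xi].
Qed.

(** By strong induction there are at least N - 2 cycles, and a number congruent to N modulo 4 that
    is at least N - 2 is at least N. For N at most 3 the congruence alone suffices. *)
Lemma leq_card_porbits N (x : 'Z_N -> int) : (1 < N)%N -> sgn_fun x ->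
  (N <= #|porbits (turn x x)|)%N.
Proof.
elim/ltn_ind: N x => N IHN x N1 sx; have := card_porbits_mod4 N1 sx.
have [N3 mod4|] := leqP N 3.
  by move: mod4; move: #|_| => c; move: N3; clear; lia.
case: N IHN N1 x sx => [|[|n]] // IHN N1 x sx n1 mod4.
have {}n1 : (1 < n)%N by lia.
have [/forallP const|/forallPn nconst] := boolP [forall i, x i == x 0].
  by rewrite card_porbits_constant // => i; apply/eqP.
have [|i [xi xi1]] := sgn_ascent sx.
  by move=> const; have [i /eqP[]] := nconst.
(* The rotation brings the signs 1, -1 found at i and i + 1 to the last two places. *)
pose z j := x (j + (i + 2%:R)); pose x' (j : 'Z_n) := z (widenZ j).
have sz : sgn_fun z by move=> j; apply: sx.
have sx' : sgn_fun x' by move=> j; apply: sz.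
have z_up : z (- 2%:R) = 1 by rewrite /z addrC addrK.
have z_down : z (-1) = -1 by rewrite /z mulr2n !addrA addrAC addNr add0r.
have rot y : #|porbits (turn z y)| = #|porbits (turn x y)| := card_porbits_rotate y (fun=> erefl).
have ins : (#|porbits (turn x' x')| <= #|porbits (turn x x)|)%N.
  (* Rows and columns are rotated in turn; then the two rows are deleted, and after a transposition
     the two columns. *)
  rewrite -rot card_porbits_transpose -rot.
  apply: leq_trans (card_porbits_insert (x' := x') N1 n1 sz (fun=> erefl) z_up z_down).
  rewrite card_porbits_transpose.
  exact: (card_porbits_insert n1 n1 sx' (fun=> erefl) z_up z_down).
have := IHN n _ x' n1 sx'; move: ins mod4; move: #|_| #|_| => a b; lia.
Qed.

End LowerBound.

(** * Loops as orbits *)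

Section Loops.

Local Open Scope ring_scope.

Variables (M N : nat) (x : {ffun 'Z_N -> int}) (y : {ffun 'Z_M -> int}).
Hypotheses (M3 : (3 <= M)%N) (N3 : (3 <= N)%N).
Hypotheses (sx : is_sign_string x) (sy : is_sign_string y).

Let h : vertex M N -> vertex M N := hstep x.
Let v : vertex M N -> vertex M N := vstep y.
Let T := turn x y.

Definition hedge (u : vertex M N) : dedge M N := (u, h u).
Definition vedge (u : vertex M N) : dedge M N := (u, v u).
Definition next_edge (e : dedge M N) : dedge M N :=
  if horizontal e then vedge e.2 else hedge e.2.

(** These inequalities make the four directions of edges mutually exclusive. *)
Lemma Zp_neq n (i : 'Z_n) : (3 <= n)%N ->
  [/\ i + 1 != i, i - 1 != i & i + 1 != i - 1].
Proof.
move=> n3; have two0 : (2%:R : 'Z_n) != 0.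
  apply/eqP => /(congr1 (@nat_of_ord _)).
  by rewrite val_Zp_nat ?modn_small //; lia.
split; rewrite -subr_eq0.
- by rewrite addrAC subrr add0r oner_eq0.
- by rewrite addrAC subrr add0r oppr_eq0 oner_eq0.
by rewrite opprB addrC addrA subrK -mulr2n.
Qed.

Lemma eq_add1 n (i k : 'Z_n) : (i == k + 1) = (k == i - 1).
Proof. by rewrite [k == _]eq_sym subr_eq. Qed.

Lemma arcP e : Defs.arc x y e = (e == hedge e.1) || (e == vedge e.1).
Proof.
case: e => [[i j] [k l]].
rewrite /Defs.arc /east /west /north /south /hedge /vedge /h /v /hstep /vstep /=.
rewrite !xpair_eqE !eqxx /=.
rewrite [i == k + 1]eq_add1 [j == l + 1]eq_add1 [j == l]eq_sym [i == k]eq_sym.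
case: (sx j) => ->; case: (sy i) => -> /=; rewrite ?mulr1z ?mulrN1z ?andbT ?andbF ?orbF //=.
Qed.

Lemma hedge_kind u : [/\ horizontal (hedge u), ~~ vertical (hedge u),
  (east (hedge u))%:Z - (west (hedge u))%:Z = x u.2 &
  (north (hedge u))%:Z - (south (hedge u))%:Z = 0].
Proof.
case: u => i j; rewrite /horizontal /vertical.
rewrite /east /west /north /south /hedge /h /hstep /= !xpair_eqE /= !eqxx.
have [i1 i2 i3] := Zp_neq i M3; have [j1 j2 j3] := Zp_neq j N3.
rewrite [j == j + 1]eq_sym (negbTE j1) !andbF !andbT.
case: (sx j) => ->; rewrite ?mulr1z ?mulrN1z ?eqxx ?subrK ?eqxx.
  by rewrite [i == _ + 1]eq_add1 (negbTE i3).
by rewrite [i - 1 == _]eq_sym (negbTE i3).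
Qed.

Lemma vedge_kind u : [/\ vertical (vedge u), ~~ horizontal (vedge u),
  (east (vedge u))%:Z - (west (vedge u))%:Z = 0 &
  (north (vedge u))%:Z - (south (vedge u))%:Z = y u.1].
Proof.
case: u => i j; rewrite /horizontal /vertical.
rewrite /east /west /north /south /vedge /v /vstep /= !xpair_eqE /= !eqxx.
have [i1 i2 i3] := Zp_neq i M3; have [j1 j2 j3] := Zp_neq j N3.
rewrite [i == i + 1]eq_sym (negbTE i1) /=.
case: (sy i) => ->; rewrite ?mulr1z ?mulrN1z ?eqxx ?subrK ?eqxx.
  by rewrite [j == _ + 1]eq_add1 (negbTE j3).
by rewrite [j - 1 == _]eq_sym (negbTE j3).
Qed.

Lemma horizontal_hedge u : horizontal (hedge u) /\ ~~ vertical (hedge u).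
Proof. by case: (hedge_kind u). Qed.

Lemma vertical_vedge u : vertical (vedge u) /\ ~~ horizontal (vedge u).
Proof. by case: (vedge_kind u). Qed.

Lemma arc_hedge u : Defs.arc x y (hedge u).
Proof. by rewrite arcP eqxx. Qed.

Lemma arc_vedge u : Defs.arc x y (vedge u).
Proof. by rewrite arcP eqxx orbT. Qed.

Lemma next_hedge u : next_edge (hedge u) = vedge (h u).
Proof. by rewrite /next_edge (horizontal_hedge u).1. Qed.

Lemma next_vedge u : next_edge (vedge u) = hedge (v u).
Proof. by rewrite /next_edge (negbTE (vertical_vedge u).2). Qed.

Lemma arc_cases (P : dedge M N -> Prop) :
  (forall u, P (hedge u)) -> (forall u, P (vedge u)) -> forall e, Defs.arc x y e -> P e.
Proof. by move=> Ph Pv e; rewrite arcP => /orP[] /eqP->. Qed.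

Lemma hedge_inj : injective hedge.
Proof. by move=> u w []. Qed.

Lemma vedge_inj : injective vedge.
Proof. by move=> u w []. Qed.

Lemma hedge_neq_vedge u w : hedge u != vedge w.
Proof.
by apply: contraTneq (horizontal_hedge u).1 => ->; exact: (vertical_vedge w).2.
Qed.

Lemma next_edge_arc e : Defs.arc x y e -> Defs.arc x y (next_edge e).
Proof.
by move: e; apply: arc_cases => u; rewrite ?next_hedge ?next_vedge ?arc_hedge ?arc_vedge.
Qed.

Lemma next_edge_inj : {in Defs.arc x y &, injective next_edge}.
Proof.
move=> e f; rewrite !unfold_in => ae af; move: e ae f af.
apply: arc_cases => u; apply: arc_cases => w; rewrite ?next_hedge ?next_vedge.
- by move=> /vedge_inj/(can_inj (hstepK x)) ->.
- by move=> e; have := hedge_neq_vedge (v w) (h u); rewrite e eqxx.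
- by move=> e; have := hedge_neq_vedge (v u) (h w); rewrite e eqxx.
- by move=> /hedge_inj/(can_inj (vstepK y)) ->.
Qed.

(** An arc has exactly one continuation of the other direction, so alternating circuits are cycles
    of the function [next_edge]. *)
Lemma alternating_circuitE c :
  alternating_circuit x y c = [&& c != [::], all (Defs.arc x y) c, uniq c & fcycle next_edge c].
Proof.
rewrite /alternating_circuit; case: (c != [::]) => //=.
case: (boolP (all _ c)) => //= c_arcs; case: (uniq c) => //=; rewrite -cycle_relI.
apply: (eq_in_cycle _ c_arcs) => e f; rewrite !unfold_in => ae af.
move: e ae f af; apply: arc_cases => u; apply: arc_cases => w /=.
all: have [hu nhu] := horizontal_hedge u; have [hw nhw] := horizontal_hedge w.
all: have [vu nvu] := vertical_vedge u; have [vw nvw] := vertical_vedge w.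
all: rewrite ?next_hedge ?next_vedge ?hu ?(negbTE nhu) ?hw ?(negbTE nhw) ?vu ?(negbTE nvu)
  ?vw ?(negbTE nvw) /= ?andbF ?andbT.
- by rewrite eq_sym; apply/esym/negbTE/hedge_neq_vedge.
- by rewrite (inj_eq vedge_inj).
- by rewrite (inj_eq hedge_inj).
- by apply/esym/negbTE/hedge_neq_vedge.
Qed.

(** Only horizontal edges count: each vertex is the tail of one horizontal arc, so different loops
    have disjoint sets of tails even where they share vertices. *)
Definition tails (c : seq (dedge M N)) : {set vertex M N} := [set u | hedge u \in c].

Lemma circuit_next c e : alternating_circuit x y c -> e \in c -> next_edge e \in c.
Proof. by rewrite alternating_circuitE => /and4P[_ _ _ fc] ec; apply: mem_fcycle ec. Qed.

Lemma circuit_hstep c u : alternating_circuit x y c -> (vedge (h u) \in c) = (u \in tails c).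
Proof.
move=> circ; rewrite inE; apply/idP/idP => [|hu]; last first.
  by rewrite -next_hedge; apply: circuit_next.
move: circ; rewrite alternating_circuitE => /and4P[_ arcs _ fc] vu.
have pc : prev c (vedge (h u)) \in c by rewrite mem_prev.
have := prev_cycle fc vu; have ap := allP arcs _ pc; move: ap pc; move: (prev _ _).
apply: arc_cases => w wc; rewrite /= ?next_hedge ?next_vedge => /eqP e.
  by move/vedge_inj/(can_inj (hstepK x)): e wc => ->.
by have := hedge_neq_vedge (v w) (h u); rewrite e eqxx.
Qed.

Lemma iter_next_hedge m u : iter m next_edge (hedge u) =
  if odd m then vedge (h (iter m./2 T u)) else hedge (iter m./2 T u).
Proof.
elim: m => // m IHm; rewrite iterS IHm /= uphalf_half; case: (odd m).
  by rewrite next_vedge /= /T turnE.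
by rewrite next_hedge.
Qed.

(** Two applications of [next_edge] to a horizontal edge perform one turn on its tail. *)
Lemma tails_porbit c u : alternating_circuit x y c -> u \in tails c ->
  tails c = porbit T u.
Proof.
move=> circ uc; have := circ; rewrite alternating_circuitE => /and4P[_ _ Uc fc].
have uc' : hedge u \in c by rewrite inE in uc.
apply/setP => w; rewrite inE -(fconnect_cycle fc uc').
apply/idP/porbitP => [con|[m ->]].
  pose m := findex next_edge (hedge u) (hedge w); exists m./2; rewrite permX.
  have := iter_findex con; rewrite -/m iter_next_hedge.
  case: (odd m) => [e|/hedge_inj //].
  by have := hedge_neq_vedge w (h (iter m./2 T u)); rewrite e eqxx.
have -> : hedge ((T ^+ m)%g u) = iter m.*2 next_edge (hedge u).
  by rewrite iter_next_hedge odd_double doubleK permX.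
exact: fconnect_iter.
Qed.

Lemma tails_neq0 c : alternating_circuit x y c -> exists u, u \in tails c.
Proof.
move=> circ; have := circ; rewrite alternating_circuitE.
case: c circ => //= e c circ /andP[/andP[ae _] _].
have ec : e \in e :: c by apply: mem_head.
move: e ae circ ec; apply: arc_cases => u circ uc; first by exists u; rewrite inE.
by exists (v u); rewrite inE -next_vedge; apply: circuit_next.
Qed.

Lemma tails_in_porbits c : alternating_circuit x y c -> tails c \in porbits T.
Proof.
by move=> circ; have [u uc] := tails_neq0 circ; rewrite (tails_porbit circ uc) imset_f.
Qed.

Lemma tails_eq_rot c d : alternating_circuit x y c -> alternating_circuit x y d ->
  tails c = tails d -> exists2 m, (m <= size c)%N & d = rot m c.
Proof.
move=> circ dirc cd; have [u uc] := tails_neq0 circ.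
have ud := uc; rewrite cd in ud; rewrite !inE in uc ud.
move: circ dirc; rewrite !alternating_circuitE.
move=> /and4P[_ _ Uc fc] /and4P[d0 _ Ud fd].
case: d d0 Ud fd ud {cd} => // e d _ Ud fd ud.
have ed : e \in e :: d by apply: mem_head.
have ec : e \in c by rewrite -(fconnect_cycle fc uc) (fconnect_cycle fd ud).
(* Both circuits, rotated to begin with the head e of d, are the orbit of e under [next_edge]. *)
exists (index e c); first exact: index_size.
by rewrite -(fingraph.orbitE fc Uc ec) (fingraph.orbitE fd Ud ed) /= eqxx rot0.
Qed.

Lemma circuit_ex u : exists2 c : dedges M N, alternating_circuit x y c & u \in tails c.
Proof.
have size_c : (size (fingraph.orbit next_edge (hedge u)) <= #|{: dedge M N}|)%N.
  by rewrite -(card_uniqP (orbit_uniq _ _)) max_card.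
exists (Bseq size_c); last by rewrite inE /= -fconnect_orbit connect0.
rewrite alternating_circuitE /=; apply/and4P; split.
- by rewrite -size_eq0 size_orbit -lt0n fingraph.order_gt0.
- apply/allP => e; rewrite -fconnect_orbit => /iter_findex <-.
  by elim: (findex _ _ _) => [|m IHm]; [apply: arc_hedge | apply: next_edge_arc].
- exact: orbit_uniq.
apply: (cycle_orbit_in (S := Defs.arc x y)); last exact: arc_hedge.
  by move=> e; apply: next_edge_arc.
exact: next_edge_inj.
Qed.

Lemma countZ (a : pred (dedge M N)) c : (count a c)%:Z = \sum_(e <- c) (a e)%:Z.
Proof. by elim: c => [|e c IHc]; rewrite ?big_nil // big_cons -IHc /= PoszD. Qed.

Lemma sum_circuit (f : dedge M N -> int) c : alternating_circuit x y c ->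
  \sum_(e <- c) f e = \sum_(u in tails c) (f (hedge u) + f (vedge (h u))).
Proof.
move=> circ; have := circ; rewrite alternating_circuitE => /and4P[_ arcs Uc _].
rewrite big_split /= big_uniq //= (bigID (@horizontal M N)) /=; congr (_ + _).
  rewrite -(big_imset f (h := hedge)) => [|u w _ _ /hedge_inj //].
  apply: eq_bigl => e; apply/andP/imsetP => [[ec he]|[u uc ->]].
    have ae := allP arcs e ec; move: e ae ec he; apply: arc_cases => u uc; last first.
      by rewrite (negbTE (vertical_vedge u).2).
    by exists u; rewrite ?inE.
  by rewrite inE in uc; rewrite uc (horizontal_hedge u).1.
rewrite -(big_imset f (h := fun u => vedge (h u))) => [|u w _ _ /vedge_inj/(can_inj (hstepK x)) //].
apply: eq_bigl => e; apply/andP/imsetP => [[ec he]|[u uc ->]].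
  have ae := allP arcs e ec; move: e ae ec he; apply: arc_cases => u uc.
    by rewrite (horizontal_hedge u).1.
  (* A vertical edge of the circuit is indexed by the tail of the horizontal edge before it. *)
  have uE : u = h (u.1 - (x u.2)%:~R, u.2) by rewrite /h /hstep /= subrK; case: (u).
  by exists (u.1 - (x u.2)%:~R, u.2); rewrite -?circuit_hstep -?uE.
by rewrite circuit_hstep // uc (vertical_vedge _).2.
Qed.

Lemma Delta_orbit_class c : alternating_circuit x y c ->
  (Delta_x c, Delta_y c) = orbit_class x y (tails c).
Proof.
move=> circ; rewrite /Delta_x /Delta_y !countZ -!sumrB !(sum_circuit _ circ).
congr pair.
  apply: eq_bigr => u _; have [_ _ -> _] := hedge_kind u.
  by have [_ _ -> _] := vedge_kind (h u); rewrite addr0.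
have [u0 /(tails_porbit circ) ->] := tails_neq0 circ.
(* Reindexing by T matches the vertical edge at [h u] with the column of [T u]. *)
rewrite [RHS](reindex_inj (@perm_inj _ T)) /=; apply: eq_big => [u|u _].
  by rewrite -!eq_porbit_mem -(porbit_perm T 1) expg1.
have [_ _ _ ->] := hedge_kind u; have [_ _ _ ->] := vedge_kind (h u).
by rewrite add0r /T turnE.
Qed.

Lemma homology_class_eq0 c : alternating_circuit x y c ->
  (homology_class c == (0, 0)) = (orbit_class x y (tails c) == (0, 0)).
Proof.
move=> circ; rewrite -(Delta_orbit_class circ) /homology_class !xpair_eqE.
by rewrite !mulf_eq0 !invr_eq0 !intr_eq0 !pnatr_eq0 !gtn_eqF ?orbF //; lia.
Qed.

Let circuits : {set dedges M N} := [set c : dedges M N | alternating_circuit x y c].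
Let loop_of (c : dedges M N) := [set d in circuits | cyclic_shift c d].

Lemma loop_of_eq : {in circuits &, forall c d,
  (loop_of c == loop_of d) = (tails c == tails d)}.
Proof.
have shift c d : c \in circuits -> d \in circuits -> cyclic_shift c d = (tails c == tails d).
  rewrite !inE => circ dirc; apply/existsP/eqP => [[m /eqP dE]|].
    by apply/setP => u; rewrite !inE dE mem_rot.
  move/(tails_eq_rot circ dirc) => [m m_size dE].
  by exists (Ordinal (m_size : (m < (size c).+1)%N)); rewrite /= dE.
move=> c d circ dirc; apply/eqP/eqP => [cd|cd].
  have : d \in loop_of d by rewrite inE dirc shift ?eqxx.
  by rewrite -cd inE dirc shift //= => /eqP.
apply/setP => e; rewrite inE [RHS]inE; case: (boolP (e \in circuits)) => //= eirc.
by rewrite !shift // cd.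
Qed.

(** Loops and cycles of T are both images of the set of circuits, with the same fibers. The
    predicates allow one proof for all, trivial and nontrivial loops. *)
Lemma card_loops_orbits (t : pred {set dedges M N}) (q : pred {set vertex M N}) :
  {in circuits, forall c, t (loop_of c) = q (tails c)} ->
  #|[set L in loops x y | t L]| = #|[set O in porbits T | q O]|.
Proof.
move=> tq; pose D := [set c in circuits | q (tails c)].
have -> : [set L in loops x y | t L] = loop_of @: D.
  apply/setP => L; rewrite inE; apply/andP/imsetP => [[/imsetP[c circ ->] tc]|[c]].
    by exists c; rewrite // inE circ -tq.
  by rewrite inE => /andP[circ qc] ->; split; [apply: imset_f | rewrite tq].
have -> : [set O in porbits T | q O] = (fun c : dedges M N => tails c) @: D.
  apply/setP => O; rewrite inE; apply/andP/imsetP => [[/imsetP[u _ ->] qu]|[c]].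
    have [c circ uc] := circuit_ex u; have cE := tails_porbit circ uc.
    by exists c; rewrite // !inE circ cE.
  by rewrite !inE => /andP[circ qc] ->; split=> //; apply: tails_in_porbits.
apply: card_imset_same_fibers => c d; rewrite inE => /andP[circ _].
by rewrite inE => /andP[dirc _]; apply: loop_of_eq.
Qed.

Lemma card_loops : #|loops x y| = #|porbits T|.
Proof.
have := @card_loops_orbits predT predT (fun _ _ => erefl).
by congr (_ = _); apply: eq_card => A; rewrite !inE andbT.
Qed.

Lemma trivial_loopE : {in circuits, forall c,
  trivial_loop (loop_of c) = (orbit_class x y (tails c) == (0, 0))}.
Proof.
move=> c circ; apply/forall_inP/eqP => [triv|c0 d].
  have := triv c; rewrite inE circ => /(_ _)/eqP; rewrite inE in circ.
  have cc : cyclic_shift c c by apply/existsP; exists ord0; rewrite rot0.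
  by move=> /(_ cc)/eqP; rewrite homology_class_eq0 // => /eqP.
rewrite inE => /andP[dirc /existsP[m /eqP dE]].
have dirc' := dirc; rewrite inE in dirc'; rewrite homology_class_eq0 //.
by rewrite (_ : tails d = tails c) ?c0 //; apply/setP => u; rewrite !inE dE mem_rot.
Qed.

Lemma card_trivial_loops :
  #|trivial_loops x y| = #|[set O in porbits T | orbit_class x y O == (0, 0)]|.
Proof. exact: card_loops_orbits trivial_loopE. Qed.

Lemma card_nontrivial_loops : #|nontrivial_loops x y| = #|nontrivial_orbits x y|.
Proof. by apply: card_loops_orbits => c circ; rewrite trivial_loopE. Qed.

End Loops.

Lemma k_sum n (x : {ffun 'Z_n -> int}) : is_sign_string x -> k x = (\sum_i x i)%R.
Proof.
move=> sx; rewrite /k -2!natz -!sum1_card !natr_sum [X in (X - _)%R]big_mkcond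
  [X in (_ - X)%R]big_mkcond -sumrB.
by apply: eq_bigr => i _; rewrite !inE; case: (sx i) => ->.
Qed.

Local Open Scope ring_scope.

Theorem theorem1p7 (M N : nat) (hM : (3 <= M)%N) (hN : (3 <= N)%N) :
  [/\ forall (x : {ffun 'Z_N -> int}) (y : {ffun 'Z_M -> int}),
        is_sign_string x -> is_sign_string y ->
        k x != 0 -> k y != 0 ->
        #|nontrivial_loops x y| = gcdn `|k x|%N `|k y|%N,
      forall (x : {ffun 'Z_N -> int}) (y : {ffun 'Z_M -> int}),
        is_sign_string x -> is_sign_string y ->
        ~~ odd #|trivial_loops x y|,
      forall x : {ffun 'Z_N -> int},
        is_sign_string x ->
        #|loops x x| = N %[mod 4] &
      (exists2 x : {ffun 'Z_N -> int}, is_sign_string x & #|loops x x| = N) /\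
      (forall x : {ffun 'Z_N -> int}, is_sign_string x -> (N <= #|loops x x|)%N)].
Proof.
have [M1 N1] : (1 < M)%N /\ (1 < N)%N by split; apply: ltnW.
split=> [x y sx sy|x y sx sy|x sx|].
- rewrite !k_sum // card_nontrivial_loops // => kx0 ky0.
  by rewrite (nontrivial_orbits_gcd M1 N1 sx sy).
- by rewrite card_trivial_loops //; apply: even_trivial_orbits.
- by rewrite card_loops //; apply: card_porbits_mod4.
split=> [|x sx]; last by rewrite card_loops //; apply: leq_card_porbits.
pose one : {ffun 'Z_N -> int} := [ffun=> 1%R].
have s1 : is_sign_string one by move=> i; left; rewrite ffunE.
exists one => //; rewrite card_loops //; apply: card_porbits_constant => //.
by move=> i; rewrite !ffunE.
Qed.
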